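(* Let $\varphi=\mathrm{id}$. Then for any $x,y\in\mathbb{X}$ and all $(s,t)\in[0,1]^2$, $$\frac1N\langle S^N_s(x),S^N_t(y)\rangle_{\mathbb{R}^N}\xrightarrow[N\to\infty]{\mathbb{L}^2}\mathcal{K}^{x,y}_{\mathrm{id}}(s,t).$$ Moreover the convergence is of order $\mathcal{O}(\frac1N)$, in the sense that $$\mathbb{E}\Big[\Big(\tfrac1N\langle S^N_s(x),S^N_t(y)\rangle_{\mathbb{R}^N}-\mathcal{K}^{x,y}_{\mathrm{id}}(s,t)\Big)^2\Big]=\mathcal{O}\big(\tfrac1N\big).$$
   Context: $\mathbb{X}=\{x\in C^0([0,1];\mathbb{R}^d): x(0)=0,\ \exists\,\dot x\in L^2([0,1];\mathbb{R}^d)\}$. Parameters $\sigma_a,\sigma_A>0$, $\sigma_b\ge0$. For $x\in\mathbb{X}$, $S^N(x):[0,1]\to\mathbb{R}^N$ is the solution of $$S^N_t(x)=a+\sum_{k=1}^d\int_0^t\big(A_kS^N_r(x)+b_k\big)\,dx^k_r,$$ with independent entries $[a]_\alpha\sim\mathcal{N}(0,\sigma_a^2)$, $[A_k]_\alpha^\beta\sim\mathcal{N}(0,\frac{\sigma_A^2}{N})$, $[b_k]_\alpha\sim\mathcal{N}(0,\sigma_b^2)$; the same $a,A_k,b_k$ are used for all paths. The function $\mathcal{K}^{x,y}_{\mathrm{id}}:[0,1]^2\to\mathbb{R}$ is the unique solution of $$\mathcal{K}^{x,y}_{\mathrm{id}}(s,t)=\sigma_a^2+\int_0^s\int_0^t\big[\sigma_A^2\mathcal{K}^{x,y}_{\mathrm{id}}(\eta,\tau)+\sigma_b^2\big]\langle\dot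 x_\eta,\dot y_\tau\rangle_{\mathbb{R}^d}\,d\tau\,d\eta.$$ *)

(* Defs.v *)
From HB Require Import structures.
From mathcomp Require Import all_boot all_order all_algebra.
From mathcomp Require Import all_classical all_reals all_analysis.

Set Implicit Arguments.
Unset Strict Implicit.
Unset Printing Implicit Defensive.
Import Order.TTheory GRing.Theory Num.Theory.
Import numFieldNormedType.Exports.

Local Open Scope classical_set_scope.
Local Open Scope ring_scope.

Definition inner {R : realType} {n : nat} (u v : 'cV[R]_n) : R :=
  \sum_(i < n) u i 0 * v i 0.

Section Paths.
Context {R : realType} {d : nat}.
Local Notation mu := (@lebesgue_measure R).

(* Functions on [0,1] are represented by total functions on R of which only
   the restriction to [0,1] is ever used. *)

Definition is_L2_derivative (x v : R -> 'cV[R]_d) : Prop :=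
  (forall k : 'I_d,
     measurable_fun (`[0, 1] : set R) (fun t => v t k 0) /\
     mu.-integrable `[0, 1] (fun t => ((v t k 0) ^+ 2)%:E)) /\
  (forall t : R, t \in `[0, 1]%R -> forall k : 'I_d,
     x t k 0 = x 0 k 0 + \int[mu]_(r in `[0, t]) v r k 0).

Definition in_X (x : R -> 'cV[R]_d) : Prop :=
  [/\ {within (`[0, 1] : set R), continuous x},
      x 0 = 0 &
      exists v : R -> 'cV[R]_d, is_L2_derivative x v].

End Paths.

Section Equations.
Context {R : realType} {d : nat}.
Local Notation mu := (@lebesgue_measure R).

(* The integral of f against dx^k over [0,t], where v is the derivative of x. *)
Definition integral_dx {N : nat} (v : R -> 'cV[R]_d) (k : 'I_d)
    (f : R -> 'cV[R]_N) (t : R) : 'cV[R]_N :=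
  \col_i \int[mu]_(r in `[0, t]) (f r i 0 * v r k 0).

Definition is_CDE_solution {N : nat} (v : R -> 'cV[R]_d)
    (a : 'cV[R]_N) (A : 'I_d -> 'M[R]_N) (b : 'I_d -> 'cV[R]_N)
    (S : R -> 'cV[R]_N) : Prop :=
  {within (`[0, 1] : set R), continuous S} /\
  forall t : R, t \in `[0, 1]%R ->
    S t = a + \sum_(k < d) integral_dx v k (fun r => A k *m S r + b k) t.

(* The equation is well posed among continuous functions on the unit square. *)
Definition is_K_id (sigma_a sigma_A sigma_b : R) (vx vy : R -> 'cV[R]_d)
    (K : R -> R -> R) : Prop :=
  {within (`[0, 1] `*` `[0, 1] : set (R * R)), continuous (fun p : R * R => K p.1 p.2)} /\
  forall s t : R, s \in `[0, 1]%R -> t \in `[0, 1]%R ->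
    K s t = sigma_a ^+ 2 +
      \int[mu]_(eta in `[0, s]) \int[mu]_(tau in `[0, t])
        ((sigma_A ^+ 2 * K eta tau + sigma_b ^+ 2) * inner (vx eta) (vy tau)).

End Equations.

Section RandomWeights.
Context {disp : measure_display} {Omega : measurableType disp} {R : realType}.
Variable P : probability Omega R.

(* Normal law with mean m and variance v.  The degenerate law N(m, 0) must be
   singled out because normal_prob m 0 is the uniform law on [0,1]. *)
Definition normal_law (m v : R) (B : set R) : \bar R :=
  if v == 0 then \d_m B else normal_prob m (Num.sqrt v) B.

Definition has_normal_law (X : {RV P >-> R}) (m v : R) : Prop :=
  forall B : set R, measurable B -> distribution P X B = normal_law m v B.

Definition mutually_independent (I : finType) (X : I -> {RV P >-> R}) : Prop :=
  forall (J : {set I}) (B : I -> set R), (forall i, measurable (B i)) ->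
    P [set w | forall i, i \in J -> B i (X i w)] =
    (\prod_(i in J) P (X i @^-1` B i))%E.

Definition entries {N d : nat} (a : 'I_N -> {RV P >-> R})
    (A : 'I_d -> 'I_N -> 'I_N -> {RV P >-> R})
    (b : 'I_d -> 'I_N -> {RV P >-> R})
    (i : 'I_N + ('I_d * 'I_N * 'I_N + 'I_d * 'I_N)) : {RV P >-> R} :=
  match i with
  | inl al => a al
  | inr (inl (k, al, be)) => A k al be
  | inr (inr (k, al)) => b k al
  end.

Definition gaussian_weights (sigma_a sigma_A sigma_b : R) {N d : nat}
    (a : 'I_N -> {RV P >-> R}) (A : 'I_d -> 'I_N -> 'I_N -> {RV P >-> R})
    (b : 'I_d -> 'I_N -> {RV P >-> R}) : Prop :=
  [/\ forall al, has_normal_law (a al) 0 (sigma_a ^+ 2),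
      forall k al be, has_normal_law (A k al be) 0 (sigma_A ^+ 2 / N%:R),
      forall k al, has_normal_law (b k al) 0 (sigma_b ^+ 2) &
      mutually_independent (entries a A b)].

Definition cvg_in_L2 (Z : nat -> Omega -> R) (c : R) : Prop :=
  (forall N, Z N \in Lfun P 2%:E) /\
  ('N[P]_2%:E [EFin \o (fun w => Z N w - c)%R])%E @[N --> \oo] --> 0%E.

End RandomWeights.

(* Main.v *)
Require Import Defs.
From HB Require Import structures.
From mathcomp Require Import all_boot all_order all_algebra.
From mathcomp Require Import all_classical all_reals all_analysis.
From mathcomp Require Import measurable_realfun.
From mathcomp Require mpoly.
From mathcomp Require Import ring lra zify.
Import - (notations) mpoly.

Set Implicit Arguments.
Unset Strict Implicit.
Unset Printing Implicit Defensive.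
Import Order.TTheory GRing.Theory Num.Theory.
Import numFieldNormedType.Exports.

Local Open Scope classical_set_scope.
Local Open Scope ring_scope.

(** Iterating the equation of [S] expands the solution at time [t] into a sum over words
[p = (k1 .. kj, u)]: the iterated integral of the path along [p], which is a number,
times the random vector [A_k1 *m .. *m A_kj *m z_u], where [z_u] is [a] or one of
the [b_k]. The inner product of two solutions divided by [N] is therefore a double
sum, with deterministic coefficients, of the quadratic forms [q p r = N^-1 * (A_k1
.. A_kj z_u)^T (A_l1 .. A_li z_v)]. As [N] grows, [q p r] concentrates around [0] if
[p] and [r] differ and around [sigma_u ^+ 2 * sigma_A ^+ (2 * j)] if they are equal,
and the Picard iteration of the equation of [K] produces precisely the sum of these
diagonal limits ([kernel_expansion_cvg], [kernel_expansion_qlimit]).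

The rate comes from a bound on the covariances of the centred forms, [5 * s ^+ 2 / N
* (h p * h r * (h p' * h r'))], where [s] is the sum of the two vector variances and
[h p = (2 * sigma_A) ^+ j * sqrt j!] ([covariance_qform]). It is obtained from
Gaussian integration by parts [E (g * F) = var * E (dF / dg)]. First the two random
vectors of each form are integrated out, which leaves products of normalized traces
of words in the [A_k] and their transposes. Integrating by parts the first letter
[A_k] of such a product pairs it with the other occurrences of the same matrix
([E_ntrs_step]): a transposed occurrence in the same trace splits this trace into
two with weight [1], any other occurrence in the same trace has weight [N^-1], and
one in another trace merges the two traces with weight [N^-2]. At most as many terms
appear as there are letters left, and two letters disappear, so the moments of [n]
letters are at most [sigma_A ^+ n * sqrt n!] ([E_ntrs_le]). The words that come from
the forms consist, up to rotation, of plain letters followed by transposed ones;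
splitting preserves this shape, so the terms of weight [1] close up into a recursion
for the limits, and the other terms are [O(1 / N)] ([E_ntrs_pair_words]).

The growth of [sqrt j!] is harmless: the iterated integrals over all words of length
[j] add up to at most a constant times [l ^+ j / j!], with [l] the length of the
path, and [\sum_j (2 * sigma_A * l) ^+ j / sqrt j!] converges. Hence the mean square
error of the expansions truncated at length [m] is at most [C / N] with [C]
independent of [m] and [N] ([mean_square_forms], [weighted_iterated_bounded]), and
Fatou's lemma passes to the limit in [m] ([fatou_mean_square]).

The combinatorial part is carried out in an abstract commutative algebra with
derivations and a functional satisfying the integration by parts formula; it is
applied to polynomials in the weights, whose means are computed from the moments of
the normal law and independence ([poly_mean_stein]). *)

(** * Words *)

Section Splits.
Variable A : eqType.
Implicit Types w : seq A.

(** The occurrences of letters in a word, each recorded as (left part, letter, right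
part): the terms of the Leibniz rule for a product along the word. *)
Fixpoint splits w : seq (seq A * A * seq A) :=
  if w is l :: w' then
    ([::], l, w') :: [seq (l :: p.1.1, p.1.2, p.2) | p <- splits w']
  else [::].

Lemma size_splits w : size (splits w) = size w.
Proof. by elim: w => //= l w IH; rewrite size_map IH. Qed.

Lemma splits_cat u v : splits (u ++ v) =
  [seq (p.1.1, p.1.2, p.2 ++ v) | p <- splits u] ++
  [seq (u ++ p.1.1, p.1.2, p.2) | p <- splits v].
Proof.
elim: u => [|l u IH] /=; first by elim: (splits v) => //= -[[? ?] ?] s <-.
by rewrite IH map_cat -!map_comp.
Qed.

Lemma mem_splits w p : p \in splits w -> w = p.1.1 ++ p.1.2 :: p.2.
Proof.
elim: w p => //= l w IH p; rewrite inE => /orP[/eqP -> //|].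
by move=> /mapP[q /IH -> ->].
Qed.

Lemma size_mem_splits w p : p \in splits w ->
  (size p.1.1 + size p.2).+1 = size w.
Proof. by move=> /mem_splits ->; rewrite size_cat /= addnS. Qed.

End Splits.

Lemma splits_map (A B : eqType) (f : A -> B) w :
  splits (map f w) = [seq (map f p.1.1, f p.1.2, map f p.2) | p <- splits w].
Proof. by elim: w => //= l w ->; rewrite -!map_comp. Qed.

Section Words.
Variable d : nat.

(** A letter [(t, k)] stands for the matrix [A_k], transposed if [t] is true. *)
Definition letter := (bool * 'I_d)%type.

Definition flip (l : letter) : letter := (~~ l.1, l.2).

Definition transpose_word (w : seq letter) := rev (map flip w).

Lemma size_transpose_word w : size (transpose_word w) = size w.
Proof. by rewrite size_rev size_map. Qed.

Lemma transpose_word_cat u v :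
  transpose_word (u ++ v) = transpose_word v ++ transpose_word u.
Proof. by rewrite /transpose_word map_cat rev_cat. Qed.

Lemma transpose_word_cons l w :
  transpose_word (l :: w) = transpose_word w ++ [:: flip l].
Proof. by rewrite -cat1s transpose_word_cat. Qed.

(** The word left when the letter [p.1.2] of a cyclic word is paired with the letter
[A_k] in front of [w] in another trace: the two traces merge into one, and [w] is
read backwards unless the paired letter is transposed. *)
Definition join_words (w : seq letter) (p : seq letter * letter * seq letter) :=
  (if p.1.2.1 then w else transpose_word w) ++ p.2 ++ p.1.1.

(** All the families obtained by pairing a letter [A_k] in front of [w] with an
occurrence of [A_k] or of its transpose in one of the words [ws]. *)
Fixpoint joins (k : 'I_d) (w : seq letter) (ws : seq (seq letter)) :
    seq (seq (seq letter)) :=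
  if ws is w' :: ws' then
    [seq join_words w p :: ws' | p <- splits w' & p.1.2.2 == k] ++
    [seq w' :: vs | vs <- joins k w ws']
  else [::].

Definition total_size (ws : seq (seq letter)) := sumn (map size ws).

Lemma size_joins k w ws : (size (joins k w ws) <= total_size ws)%N.
Proof.
elim: ws => //= w' ws IH; rewrite size_cat !size_map /total_size /=.
by rewrite leq_add // size_filter -(size_splits w') count_size.
Qed.

Lemma total_size_joins k w ws vs : vs \in joins k w ws ->
  (total_size vs).+1 = (size w + total_size ws)%N.
Proof.
elim: ws vs => //= w' ws IH vs; rewrite mem_cat => /orP[|] /mapP[p].
  rewrite mem_filter => /andP[_ /size_mem_splits szp] ->.
  rewrite /total_size /= /join_words !size_cat -szp.
  case: ifP => _; rewrite ?size_transpose_word;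
    by rewrite -addnA (addnC (size _) (size p.1.1)) addSn addnS.
by move=> /IH pP ->; rewrite /total_size /= -addnS pP addnCA.
Qed.

End Words.

(** * Factorial weights *)

Lemma norm_sum_le_count (R : numDomainType) (J : eqType) (r : seq J) (Q : pred J)
    (F : J -> R) B :
  (forall j, j \in r -> Q j -> `|F j| <= B) ->
  `|\sum_(j <- r | Q j) F j| <= (count Q r)%:R * B.
Proof.
move=> FB; apply: (le_trans (ler_norm_sum _ _ _)).
have -> : (count Q r)%:R * B = \sum_(j <- r | Q j) B.
  by rewrite big_const_seq iter_addr_0 mulr_natl.
by rewrite big_seq_cond [leRHS]big_seq_cond; apply: ler_sum => j /andP[]; apply: FB.
Qed.

(** The bound [sqrt n!] on moments reproduces itself under removal of two letters at the
price of [n.+1] terms because [n.+1 ^ 2 <= n.+1 * n.+2]. *)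
Lemma sqrt_fact_step (R : rcfType) n :
  n.+1%:R * Num.sqrt (n`!)%:R <= Num.sqrt (n.+2`!)%:R :> R.
Proof.
rewrite -[n.+1%:R]ger0_norm ?ler0n // -sqrtr_sqr -sqrtrM ?sqr_ge0 //.
rewrite ler_wsqrtr // -natrX -natrM ler_nat !factS mulnA leq_mul //.
by rewrite -mulnn leq_mul.
Qed.

(** The binomial coefficient of [m + n] over [m] is one of the terms of the expansion of
[(1 + 1) ^ (m + n)]. *)
Lemma leq_fact_add m n : ((m + n)`! <= 2 ^ (m + n) * (m`! * n`!))%N.
Proof.
rewrite -(@bin_fact (m + n) m) ?leq_addr // addKn leq_mul2r; apply/orP; right.
rewrite (expnDn 1 1) (bigD1 (inord m)) //= inordK ?ltnS ?leq_addr //.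
by rewrite !exp1n !muln1 leq_addr.
Qed.

(** A majorant of [sqrt n!] that factorizes: [sqrt (i + j)!] is not bounded by [sqrt i!
* sqrt j!], but it is by [2 ^ (i + j)] times this product. *)
Definition root_factorial_weight (R : rcfType) (c : R) (n : nat) : R :=
  (2 * c) ^+ n * Num.sqrt (n`!)%:R.

Lemma root_factorial_weight_ge (R : rcfType) (c : R) n : 0 <= c ->
  c ^+ n <= root_factorial_weight c n.
Proof.
move=> c0; rewrite /root_factorial_weight exprMn mulrAC ler_peMl ?exprn_ge0 //.
apply: mulr_ege1; first by rewrite exprn_ege1 // ler1n.
by rewrite -[leLHS]sqrtr1 ler_wsqrtr // ler1n fact_gt0.
Qed.

(** The factorial of a sum of four terms is at most [4 ^ n] times the product of the
factorials, by [leq_fact_add] used on two levels; the square root turns [4] into the [2] of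
the weight. *)
Lemma root_factorial_split (R : rcfType) (c : R) i j k l : 0 <= c ->
  c ^+ (i + j + (k + l)) * Num.sqrt ((i + j + (k + l))`!)%:R <=
  root_factorial_weight c i * root_factorial_weight c j *
  (root_factorial_weight c k * root_factorial_weight c l).
Proof.
move=> c0; rewrite /root_factorial_weight; set n := (i + j + (k + l))%N.
have le_fact : (n`! <= 2 ^ n * 2 ^ n * (i`! * j`! * (k`! * l`!)))%N.
  apply: (leq_trans (leq_fact_add _ _)); rewrite -mulnA leq_mul2l; apply/orP; right.
  apply: leq_trans (leq_mul (leq_fact_add i j) (leq_fact_add k l)) _.
  by rewrite mulnACA -expnD.
have -> : (2 * c) ^+ i * Num.sqrt (i`!)%:R * ((2 * c) ^+ j * Num.sqrt (j`!)%:R) *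
  ((2 * c) ^+ k * Num.sqrt (k`!)%:R * ((2 * c) ^+ l * Num.sqrt (l`!)%:R)) =
  c ^+ n * Num.sqrt ((2 ^ n * 2 ^ n * (i`! * j`! * (k`! * l`!)))%:R).
  rewrite !natrM !sqrtrM ?mulr_ge0 ?ler0n // -[X in _ = c ^+ n * (X * _)]expr2.
  rewrite sqr_sqrtr ?ler0n // natrX /n !exprD !exprMn; ring.
apply: ler_wpM2l; first exact: exprn_ge0.
by rewrite ler_wsqrtr // ler_nat.
Qed.

(** * Moments of traces by Gaussian integration by parts *)

Section Trace.
Variables (R : rcfType) (T : comAlgType R) (N d : nat).
Local Notation I := ('I_N + ('I_d * 'I_N * 'I_N + 'I_d * 'I_N))%type.
Local Notation iA k al be := (inr (inl (k, al, be)) : I).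
Variables (X : I -> T) (D : I -> {linear T -> T}) (E : T -> R).
Variables (sa sA sb : R).
Hypothesis N_gt0 : (0 < N)%N.
Hypothesis DM : forall i p q, D i (p * q) = D i p * q + p * D i q.
Hypothesis DX : forall i j, D i (X j) = (i == j)%:R.
Hypothesis E1 : E 1 = 1.
Hypothesis ED : forall p q, E (p + q) = E p + E q.
Hypothesis EZ : forall c p, E (c *: p) = c * E p.
Definition weight_variance (i : I) : R :=
  match i with
  | inl _ => sa ^+ 2
  | inr (inl _) => sA ^+ 2 / N%:R
  | inr (inr _) => sb ^+ 2
  end.
(** Integration by parts for a centred Gaussian variable, [E] being the mean and [D i]
the derivative with respect to the weight [i]. *)
Hypothesis Stein : forall i p, E (X i * p) = weight_variance i * E (D i p).

Local Notation letter := (letter d).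

Definition weight_matrix (k : 'I_d) : 'M[T]_N := \matrix_(al, be) X (iA k al be).

Definition letter_matrix (l : letter) : 'M[T]_N :=
  if l.1 then (weight_matrix l.2)^T else weight_matrix l.2.

Definition word_matrix (w : seq letter) : 'M[T]_N :=
  foldr (fun l M => letter_matrix l *m M) 1%:M w.

(** The trace normalized so that the identity matrix has trace [1]. *)
Definition ntr (w : seq letter) : T := N%:R^-1 *: \tr (word_matrix w).

Definition ntrs (ws : seq (seq letter)) : T := \prod_(w <- ws) ntr w.

Lemma word_matrix_cat u v :
  word_matrix (u ++ v) = word_matrix u *m word_matrix v.
Proof. by elim: u => [|l u IH] /=; rewrite ?mul1mx // IH mulmxA. Qed.

Lemma word_matrix_transpose w :
  word_matrix (transpose_word w) = (word_matrix w)^T.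
Proof.
elim: w => [|l w IH]; first by rewrite /= trmx1.
rewrite transpose_word_cons word_matrix_cat IH /= mulmx1 trmx_mul; congr (_ *m _).
by rewrite /letter_matrix /=; case: l.1 => //=; rewrite trmxK.
Qed.

Lemma ntr_transpose w : ntr (transpose_word w) = ntr w.
Proof. by rewrite /ntr word_matrix_transpose mxtrace_tr. Qed.

Lemma ntr_catC u v : ntr (u ++ v) = ntr (v ++ u).
Proof. by rewrite /ntr !word_matrix_cat mxtrace_mulC. Qed.

Let E0 : E 0 = 0.
Proof. by rewrite -(scale0r 0) EZ mul0r. Qed.

Lemma E_sum (J : Type) (r : seq J) (Q : pred J) (F : J -> T) :
  E (\sum_(j <- r | Q j) F j) = \sum_(j <- r | Q j) E (F j).
Proof. exact: (big_morph E ED E0). Qed.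

Let N0 : N%:R != 0 :> R.
Proof. by rewrite pnatr_eq0 -lt0n. Qed.

Lemma ntr_nil : ntr [::] = 1.
Proof.
by rewrite /ntr /= mxtrace1 -(scaler_nat N (1 : T)) scalerA mulVf // scale1r.
Qed.

Lemma ntrs_cons w ws : ntrs (w :: ws) = ntr w * ntrs ws.
Proof. by rewrite /ntrs big_cons. Qed.

Lemma D1 i : D i 1 = 0.
Proof.
have /eqP := DM i 1 1.
by rewrite !mulr1 mul1r -subr_eq subrr eq_sym => /eqP.
Qed.

Local Notation dmx i M := (map_mx (D i) M).

Lemma dmx_mul m n p i (A : 'M[T]_(m, n)) (B : 'M[T]_(n, p)) :
  dmx i (A *m B) = dmx i A *m B + A *m dmx i B.
Proof.
apply/matrixP => a b; rewrite !mxE raddf_sum -big_split /=.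
by apply: eq_bigr => c _; rewrite DM !mxE.
Qed.

Lemma dmx1 i : dmx i (1%:M : 'M[T]_N) = 0.
Proof.
apply/matrixP => a b; rewrite !mxE; case: eqP => _; last exact: raddf0.
by rewrite /= D1.
Qed.

Lemma dmx_word i w : dmx i (word_matrix w) =
  \sum_(p <- splits w)
     word_matrix p.1.1 *m dmx i (letter_matrix p.1.2) *m word_matrix p.2.
Proof.
elim: w => [|l w IH] /=; first by rewrite big_nil dmx1.
rewrite dmx_mul IH big_cons big_map /= mul1mx; congr (_ + _).
by rewrite mulmx_sumr; apply: eq_bigr => p _; rewrite !mulmxA.
Qed.

Lemma matrix_index_eq k al be k' al' be' :
  (iA k al be == iA k' al' be') = [&& k' == k, al' == al & be' == be].
Proof. by rewrite [LHS]/eq_op /= /eq_op /= !xpair_eqE -andbA !(eq_sym k, eq_sym al, eq_sym be). Qed.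

Lemma dmx_letter k al be l : dmx (iA k al be) (letter_matrix l) =
  (l.2 == k)%:R *: (if l.1 then delta_mx be al else delta_mx al be).
Proof.
apply/matrixP => a b; rewrite /letter_matrix.
case: l => -[] j; rewrite /= !mxE DX matrix_index_eq; case: (j == k);
  by rewrite ?mul1r ?mul0r //= andbC.
Qed.

Lemma mul_delta_mxE (U V : 'M[T]_N) al be i j :
  (U *m delta_mx al be *m V) i j = U i al * V be j.
Proof.
rewrite -[delta_mx al be](mul_delta_mx (0 : 'I_1)) mulmxA -colE -mulmxA -rowE.
by rewrite !mxE big_ord1 !mxE.
Qed.

Lemma scale_bool (c : bool) (x : T) : (c%:R : R) *: x = c%:R * x.
Proof. by rewrite scaler_nat mulr_natl. Qed.

(** Summing over all entries the matrix unit that the derivative puts in place of [l]: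
between [u] and [v] it yields the product of two traces if [l] is transposed, and
otherwise a single trace in which [u] is reversed. *)
Lemma contract_entry k l u v :
  \sum_al \sum_be
    (word_matrix u *m dmx (iA k al be) (letter_matrix l) *m word_matrix v) be al
  = (l.2 == k)%:R *: (if l.1 then N%:R ^+ 2 *: (ntr u * ntr v)
                      else N%:R *: ntr (transpose_word u ++ v)).
Proof.
under eq_bigr do under eq_bigr do
  rewrite dmx_letter -scalemxAr -scalemxAl mxE.
under eq_bigr do rewrite -mulr_sumr.
rewrite -mulr_sumr scale_bool; congr (_ * _).
case: l => -[] j /=.
  under eq_bigr do under eq_bigr do rewrite mul_delta_mxE.
  rewrite /ntr -scalerAl -scalerAr !scalerA expr2 mulfK // mulfV // scale1r.
  rewrite /mxtrace exchange_big /= mulr_suml.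
  by apply: eq_bigr => a _; rewrite mulr_sumr.
under eq_bigr do under eq_bigr do rewrite mul_delta_mxE.
rewrite /ntr scalerA mulfV // scale1r word_matrix_cat word_matrix_transpose.
rewrite /mxtrace; apply: eq_bigr => a _; rewrite mxE.
by apply: eq_bigr => b _; rewrite mxE.
Qed.

Lemma D_ntr i w : D i (ntr w) = N%:R^-1 *: \tr (dmx i (word_matrix w)).
Proof.
rewrite linearZ /= /mxtrace raddf_sum; congr (_ *: _).
by apply: eq_bigr => a _; rewrite mxE.
Qed.

Lemma mxtrace_delta_mul (M : 'M[T]_N) al be : \tr (delta_mx al be *m M) = M be al.
Proof.
rewrite /mxtrace (bigD1 al) //= -[delta_mx al be](mul_delta_mx (0 : 'I_1)).
rewrite -mulmxA -rowE mxE big_ord1 !mxE !eqxx mul1r big1 ?addr0 // => i /negbTE ia.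
by rewrite mxE big_ord1 !mxE ia mul0r.
Qed.

(** When the derivative hits a letter of another trace, the sum over all entries glues
the two matrix products into one trace. *)
Lemma contract_trace k w u l v :
  \sum_al \sum_be word_matrix w be al * (N%:R^-1 *:
     \tr (word_matrix u *m dmx (iA k al be) (letter_matrix l) *m word_matrix v))
  = (l.2 == k)%:R *: ntr (join_words w (u, l, v)).
Proof.
under eq_bigr do under eq_bigr do
  rewrite dmx_letter -scalemxAr -scalemxAl mxtraceZ -scalerAr mulrCA.
under eq_bigr do rewrite -scaler_sumr -mulr_sumr.
rewrite -scaler_sumr -mulr_sumr scale_bool scalerAr; congr (_ * _).
rewrite /ntr /join_words !word_matrix_cat /=; congr (_ *: _).
case: l => -[] j /=;
  under eq_bigr do under eq_bigr do
    rewrite -mulmxA mxtrace_mulC -mulmxA mxtrace_delta_mul.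
  rewrite exchange_big /=; apply: eq_bigr => be _; rewrite [RHS]mxE.
  by apply: eq_bigr.
rewrite word_matrix_transpose; apply: eq_bigr => al _; rewrite [RHS]mxE.
by apply: eq_bigr => be _; rewrite [_^T _ _]mxE.
Qed.

Lemma contract_ntrs k w ws :
  \sum_al \sum_be word_matrix w be al * D (iA k al be) (ntrs ws)
  = \sum_(vs <- joins k w ws) ntrs vs.
Proof.
elim: ws => [|w' ws IH] /=.
  by rewrite big_nil big1 // => al _; rewrite big1 // => be _;
     rewrite /ntrs big_nil D1 mulr0.
rewrite big_cat !big_map big_filter /=.
under eq_bigr do under eq_bigr do rewrite ntrs_cons DM mulrDr.
under eq_bigr do rewrite big_split /=.
rewrite big_split /=; congr (_ + _); last first.
  under [RHS]eq_bigr do rewrite ntrs_cons.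
  rewrite -mulr_sumr -IH mulr_sumr; apply: eq_bigr => al _.
  by rewrite mulr_sumr; apply: eq_bigr => be _; rewrite mulrCA.
transitivity (\sum_(p <- splits w') (p.1.2.2 == k)%:R *: ntr (join_words w p) * ntrs ws);
  last first.
  rewrite [RHS]big_mkcond /=; apply: eq_bigr => p _; rewrite ntrs_cons.
  by case: ifP => _; rewrite ?scale1r ?scale0r ?mul0r.
rewrite -mulr_suml.
under [in RHS]eq_bigr => p _.
  have -> : join_words w p = join_words w (p.1.1, p.1.2, p.2).
    by case: p => [[]].
  rewrite -contract_trace; over.
rewrite [in RHS]exchange_big mulr_suml /=; apply: eq_bigr => al _.
rewrite [in RHS]exchange_big mulr_suml /=; apply: eq_bigr => be _.
rewrite -mulr_sumr mulrA; congr (_ * _ * _).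
rewrite D_ntr dmx_word -scaler_sumr; congr (_ *: _).
by rewrite raddf_sum.
Qed.

(** Integrate by parts every entry of the leading [A_k], using the Leibniz rule along
the word [w] ([contract_entry]) and across the other traces ([contract_ntrs]). Only
the splitting terms keep the order [1] in [N]. *)
Lemma E_ntrs_step k w ws : E (ntrs (((false, k) :: w) :: ws)) =
  sA ^+ 2 * (\sum_(p <- splits w | (p.1.2.2 == k) && p.1.2.1)
                E (ntrs (p.1.1 :: p.2 :: ws))
    + N%:R^-1 * \sum_(p <- splits w | (p.1.2.2 == k) && ~~ p.1.2.1)
                E (ntrs ((transpose_word p.1.1 ++ p.2) :: ws))
    + N%:R^-1 ^+ 2 * \sum_(vs <- joins k w ws) E (ntrs vs)).
Proof.
rewrite ntrs_cons /ntr -scalerAl EZ /mxtrace mulr_suml E_sum.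
have -> : \sum_(i < N) E ((letter_matrix (false, k) *m word_matrix w) i i * ntrs ws)
  = \sum_al \sum_be (sA ^+ 2 / N%:R) *
      E (D (iA k al be) (word_matrix w be al) * ntrs ws +
         word_matrix w be al * D (iA k al be) (ntrs ws)).
  apply: eq_bigr => al _; rewrite mxE mulr_suml E_sum.
  by apply: eq_bigr => be _; rewrite mxE -mulrA Stein DM.
under eq_bigr do rewrite -mulr_sumr.
rewrite -mulr_sumr mulrCA -mulrA; congr (_ * _); rewrite mulrA -expr2.
under eq_bigr do under eq_bigr do rewrite ED.
under eq_bigr do rewrite big_split /=.
rewrite big_split /= mulrDr; congr (_ + _); last first.
  congr (_ * _).
  rewrite -E_sum -contract_ntrs E_sum; apply: eq_bigr => al _.
  by rewrite E_sum.
have -> : \sum_(al < N) \sum_(be < N)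
    E (D (iA k al be) (word_matrix w be al) * ntrs ws) =
  \sum_(p <- splits w) E ((p.1.2.2 == k)%:R *: (if p.1.2.1 then N%:R ^+ 2 *: (ntr p.1.1 * ntr p.2)
                      else N%:R *: ntr (transpose_word p.1.1 ++ p.2)) * ntrs ws).
  under [RHS]eq_bigr => p _ do rewrite -contract_entry mulr_suml E_sum.
  rewrite [RHS]exchange_big /=; apply: eq_bigr => al _.
  under [RHS]eq_bigr => p _ do rewrite mulr_suml E_sum.
  rewrite [RHS]exchange_big /=; apply: eq_bigr => be _.
  rewrite -E_sum -mulr_suml; congr (E (_ * _)).
  by have /matrixP/(_ be al) := dmx_word (iA k al be) w; rewrite !mxE => ->; rewrite summxE.
rewrite [in RHS]big_mkcond [in X in _ = _ + _ * X]big_mkcond /= !mulr_sumr -big_split /=.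
apply: eq_bigr => p _; case: (_ == k) => /=; last first.
  by rewrite scale0r mul0r E0 !mulr0 addr0.
rewrite scale1r; case: ifP => _ /=; rewrite -[X in E X]scalerAl EZ ?mulr0 ?addr0 ?add0r.
  by rewrite !ntrs_cons !mulrA; field.
by rewrite ntrs_cons; field.
Qed.

(** The letters of [w] that do not split the trace and the letters of the other words
contribute [c] terms of weight at most [N^-1]; together with the splitting ones there are at
most as many terms as remaining letters. *)
Lemma E_ntrs_step_bound k w ws B :
  (forall vs, (total_size vs).+2 = total_size (((false, k) :: w) :: ws) ->
     `|E (ntrs vs)| <= B) ->
  let lead := fun p : seq letter * letter * seq letter =>
    (p.1.2.2 == k) && p.1.2.1 in
  exists2 c : nat, (c + count lead (splits w) <= size w + total_size ws)%N &
   `|E (ntrs (((false, k) :: w) :: ws)) - sA ^+ 2 *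
      \sum_(p <- splits w | lead p) E (ntrs (p.1.1 :: p.2 :: ws))|
     <= sA ^+ 2 * (N%:R^-1 * (c%:R * B)).
Proof.
move=> HB lead.
pose other (p : seq letter * letter * seq letter) := (p.1.2.2 == k) && ~~ p.1.2.1.
exists (count other (splits w) + size (joins k w ws))%N.
  rewrite addnAC leq_add ?size_joins // addnC.
  rewrite -(size_splits w) -count_predUI (@eq_count _ (predI _ _) pred0); last first.
    by move=> p /=; rewrite /lead /other; case: (_ == _); case: (p.1.2.1).
  by rewrite count_pred0 addn0 count_size.
rewrite E_ntrs_step -mulrBr -[X in X - _]addrA [X in X - _]addrC addrK.
rewrite normrM (ger0_norm (sqr_ge0 _)).
apply: ler_wpM2l; first exact: sqr_ge0.
have iN0 : 0 <= N%:R^-1 :> R by rewrite invr_ge0 ler0n.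
have iN1 : N%:R^-1 <= 1 :> R by rewrite invf_le1 ?ler1n // ltr0n.
apply: (le_trans (ler_normD _ _)).
rewrite natrD mulrDl mulrDr expr2 -mulrA !(normrM N%:R^-1) !(ger0_norm iN0).
have totalE u v : ((size u + size v).+1 = size w ->
    (total_size ((transpose_word u ++ v) :: ws)).+2 =
    total_size (((false, k) :: w) :: ws))%N.
  by rewrite /total_size /= size_cat size_transpose_word => <-; rewrite !addSn.
apply: lerD; apply: ler_wpM2l => //.
  apply: norm_sum_le_count => p pw _; apply: HB; apply: totalE.
  exact: size_mem_splits.
apply: le_trans (_ : 1 * _ <= _).
  by apply: ler_pM.
rewrite mul1r -count_predT.
apply: norm_sum_le_count => vs vsj _; apply: HB.
by rewrite (total_size_joins vsj) /total_size /= addSn.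
Qed.

Hypothesis sA_ge0 : 0 <= sA.

Definition word_bound n : R := sA ^+ n * Num.sqrt (n`!)%:R.

Lemma word_bound_ge0 n : 0 <= word_bound n.
Proof. by rewrite mulr_ge0 ?exprn_ge0 ?sqrtr_ge0. Qed.

(** One integration by parts removes two letters, creates at most [n] terms and gains
[sA ^+ 2]; the bound is stable under this operation by [sqrt_fact_step]. *)
Lemma word_bound_step n c : (c <= n)%N ->
  sA ^+ 2 * (c%:R * word_bound n.-1) <= word_bound n.+1.
Proof.
case: n => [|n] cn.
  by move: cn; rewrite leqn0 => /eqP ->; rewrite mul0r mulr0 word_bound_ge0.
rewrite /word_bound /=; set r := Num.sqrt _.
have -> : sA ^+ 2 * (c%:R * (sA ^+ n * r)) = sA ^+ n.+2 * (c%:R * r).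
  by rewrite !exprS; ring.
apply: ler_wpM2l; first exact: exprn_ge0.
apply: le_trans (sqrt_fact_step R n).
by apply: ler_wpM2r; rewrite ?sqrtr_ge0 ?ler_nat.
Qed.

Let invN_ge0 : 0 <= N%:R^-1 :> R. Proof. by rewrite invr_ge0 ler0n. Qed.
Let invN_le1 : N%:R^-1 <= 1 :> R. Proof. by rewrite invf_le1 ?ler1n // ltr0n. Qed.

(** A trace is invariant under transposition and cyclic rotation, so a leading
transposed letter can be exchanged for a plain one. *)
Lemma ntr_flip_head k w : ntr ((true, k) :: w) = ntr ((false, k) :: transpose_word w).
Proof.
by rewrite -ntr_transpose transpose_word_cons ntr_catC.
Qed.

(** Induction on the total number of letters, with [E_ntrs_step_bound] and
[word_bound_step]; every term of the recursion is counted with weight at most [1]. *)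
Lemma E_ntrs_le ws : `|E (ntrs ws)| <= word_bound (total_size ws).
Proof.
have [m] := ubnP (total_size ws); elim: m ws => // m IH.
elim=> [_|[|l w] ws IHws].
- by rewrite /ntrs big_nil E1 normr1 /word_bound fact0 expr0 mul1r sqrtr1.
- by rewrite ntrs_cons ntr_nil mul1r /total_size /=; apply: IHws.
(* the first letter may be assumed to be plain, see [ntr_flip_head] *)
wlog -> : l w {IHws} / l = (false, l.2) => [wlog_false|].
  case: l IHws => -[] k IHws; last exact: wlog_false.
  rewrite ntrs_cons ntr_flip_head -ntrs_cons => szm.
  have := wlog_false (false, k) (transpose_word w) erefl.
  by rewrite /total_size /= size_transpose_word; apply.
rewrite /total_size /= addSn ltnS -/(total_size ws) => szm.
set n := (_ + _)%N in szm *.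
have IHn vs : (total_size vs).+2 = n.+1 -> `|E (ntrs vs)| <= word_bound n.-1.
  by move=> [tv]; rewrite -tv; apply: IH; rewrite (leq_trans _ szm) // -tv.
have [|c cle] := @E_ntrs_step_bound l.2 w ws (word_bound n.-1).
  by move=> vs; rewrite /total_size /= addSn; apply: IHn.
set lead := fun p : seq letter * letter * seq letter => _ in cle *.
set S := \sum_(p <- _ | _) _ => Sle.
have SB : `|S| <= (count lead (splits w))%:R * word_bound n.-1.
  apply: norm_sum_le_count => p /size_mem_splits pw _; apply: IHn.
  by rewrite /total_size /= addnA -addSn -addSn pw /n.
rewrite -[E _](subrK (sA ^+ 2 * S)); apply: (le_trans (ler_normD _ _)).
apply: le_trans (word_bound_step cle).
rewrite natrD mulrDl mulrDr; apply: lerD.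
  apply: (le_trans Sle); apply: ler_wpM2l; first exact: sqr_ge0.
  by rewrite ler_piMl // mulr_ge0 ?ler0n ?word_bound_ge0.
by rewrite normrM (ger0_norm (sqr_ge0 _)) ler_wpM2l ?sqr_ge0.
Qed.

(** The words [A_i1 .. A_ij A_l1^T .. A_lm^T]. The trace of a matrix of this form
splits, at leading order, into traces of the same form, which makes the recursion
for their limits closed. *)
Definition pair_word (p : seq 'I_d * seq 'I_d) : seq letter :=
  map (pair false) p.1 ++ map (pair true) p.2.

(** The limit of the normalized trace of [pair_word p]: only the pairing that nests the
plain letters with the transposed ones has order [1]. *)
Definition tau (p : seq 'I_d * seq 'I_d) : R :=
  (p.1 == rev p.2)%:R * sA ^+ (size p.1 + size p.2).

Lemma size_pair_word p : size (pair_word p) = (size p.1 + size p.2)%N.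
Proof. by rewrite size_cat !size_map. Qed.

Lemma transpose_pair_word I :
  transpose_word (pair_word ([::], I)) = pair_word (rev I, [::]).
Proof. by rewrite /pair_word /transpose_word cats0 /= map_rev -map_comp. Qed.

(** In such a word the plain letters come first, so the splitting occurrences are those
among the transposed letters. *)
Lemma lead_pair_word k J I (F : seq letter -> seq letter -> R) :
  \sum_(p <- splits (pair_word (J, I)) | (p.1.2.2 == k) && p.1.2.1) F p.1.1 p.2
  = \sum_(q <- splits I | q.1.2 == k)
      F (pair_word (J, q.1.1)) (pair_word ([::], q.2)).
Proof.
rewrite splits_cat big_cat /= !splits_map -!map_comp !big_map /=.
rewrite big_pred0 ?add0r; last by move=> ?; rewrite /= andbF.
by apply: eq_bigl => q; rewrite andbT.
Qed.

(** Of all the splittings, only the one at the last transposed letter has a nonzero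
limit, since the right part consists of transposed letters only. *)
Lemma tau_step k J I :
  \sum_(q <- splits I | q.1.2 == k) tau (J, q.1.1) * tau ([::], q.2)
  = (k :: J == rev I)%:R * sA ^+ (size J + (size I).-1).
Proof.
case/lastP: I => [|I k']; first by rewrite /= big_nil mul0r.
rewrite rev_rcons eqseq_cons -cats1 splits_cat big_cat /= big_map /=.
rewrite big1 ?add0r => [|q _]; last first.
  by rewrite {2}/tau /= rev_cat /= mul0r mulr0.
rewrite big_cons big_nil cats0 /tau /= size_cat addn1 eq_sym /=.
by case: (k == k') => /=; rewrite ?mul0r // ?addr0 expr0 !mulr1.
Qed.

Definition taus ps := \prod_(p <- ps) tau p.

(** The limits obey the recursion of [E_ntrs_step] without its [N^-1] terms
([tau_step]). The non-splitting terms are bounded by [E_ntrs_le] and the splitting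
ones by induction, and the two counts add up to at most the number of remaining
letters, so that the error is again [N^-1 * word_bound]. *)
Lemma E_ntrs_pair_words ps (vs := map pair_word ps) :
  `|E (ntrs vs) - taus ps| <= N%:R^-1 * word_bound (total_size vs).
Proof.
rewrite {}/vs; have [m] := ubnP (total_size (map pair_word ps)).
elim: m ps => // m IH.
have head k J I ps : (total_size (map pair_word ((k :: J, I) :: ps)) < m.+1)%N ->
    `|E (ntrs (map pair_word ((k :: J, I) :: ps))) - taus ((k :: J, I) :: ps)|
    <= N%:R^-1 * word_bound (total_size (map pair_word ((k :: J, I) :: ps))).
  rewrite /total_size /= addSn ltnS -/(total_size _) -/(pair_word (J, I)) => szm.
  set vs := map pair_word ps in szm *.
  set n := (_ + _)%N in szm *.
  have [|c cle] := @E_ntrs_step_bound k (pair_word (J, I)) vs (word_bound n.-1).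
    move=> us; rewrite {2}/total_size /= addSn => -[tu].
    by rewrite (_ : n = (total_size us).+1) //; apply: E_ntrs_le.
  set lead := fun p : seq letter * letter * seq letter => _ in cle *.
  rewrite (lead_pair_word _ _ _ (fun u v => E (ntrs (u :: v :: vs)))).
  set S := \sum_(q <- _ | _) _ => Sle.
  pose S' := \sum_(q <- splits I | q.1.2 == k) taus ((J, q.1.1) :: ([::], q.2) :: ps).
  have S'E : sA ^+ 2 * S' = taus ((k :: J, I) :: ps).
    rewrite /S' /taus; under [X in _ * X = _]eq_bigr do rewrite !big_cons mulrA.
    rewrite -mulr_suml tau_step big_cons mulrA; congr (_ * _).
    rewrite mulrCA /tau /=; case: eqP => [IE|_]; last by rewrite !mul0r.
    rewrite -exprD; congr (_ * _ ^+ _).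
    by rewrite -(size_rev I) -IE /= addSn addnS.
  have cntE : count lead (splits (pair_word (J, I))) = count (fun q => q.1.2 == k) (splits I).
    rewrite /pair_word splits_cat count_cat !splits_map -!map_comp !count_map /=.
    rewrite (@eq_count _ _ pred0) ?count_pred0 ?add0n; last by move=> ?; rewrite /lead /= andbF.
    by apply: eq_count => q; rewrite /lead /= andbT.
  (* the splitting terms are again products of traces of words of the same shape *)
  have SB : `|S - S'| <= N%:R^-1 * ((count lead (splits (pair_word (J, I))))%:R * word_bound n.-1).
    rewrite -sumrB cntE mulrCA; apply: norm_sum_le_count => q /size_mem_splits qI _.
    have szq : (total_size (map pair_word [:: (J, q.1.1), ([::], q.2) & ps])).+1 = n.
      rewrite /n /total_size /= -/vs !size_pair_word /= -qI add0n.
      by rewrite [in RHS]addnS addSn !addnA.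
    have -> : n.-1 = total_size (map pair_word [:: (J, q.1.1), ([::], q.2) & ps]).
      by rewrite -szq.
    by apply: (IH [:: (J, q.1.1), ([::], q.2) & ps]); rewrite szq ltnW.
  rewrite -S'E -[X in X - _](subrK (sA ^+ 2 * S)) -addrA -mulrBr.
  apply: (le_trans (ler_normD _ _)).
  apply: (@le_trans _ _ (N%:R^-1 * (sA ^+ 2 *
    ((c + count lead (splits (pair_word (J, I))))%:R * word_bound n.-1)))); last first.
    by apply: ler_wpM2l => //; apply: word_bound_step.
  rewrite natrD mulrDl !mulrDr; apply: lerD; first by rewrite mulrCA.
  by rewrite -mulrDr normrM (ger0_norm (sqr_ge0 _)) mulrCA ler_wpM2l ?sqr_ge0.
elim=> [_|[[|k J] I] ps IHps]; last exact: head.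
  by rewrite /ntrs /taus !big_nil E1 subrr normr0 mulr_ge0 ?word_bound_ge0.
(* a word of transposed letters only is turned into one of plain letters *)
have tE : ntrs (map pair_word (([::], I) :: ps)) = ntrs (map pair_word ((rev I, [::]) :: ps)).
  by rewrite /= !ntrs_cons -transpose_pair_word ntr_transpose.
have tauE : taus (([::], I) :: ps) = taus ((rev I, [::]) :: ps).
  rewrite /taus !big_cons /tau /= size_rev addn0; congr (_%:R * _ * _).
  by rewrite eq_sym.
have szE : total_size (map pair_word (([::], I) :: ps)) =
    total_size (map pair_word ((rev I, [::]) :: ps)).
  by rewrite /total_size /= !size_pair_word size_rev addn0.
rewrite tE tauE szE.
case EI : (rev I) => [|k J]; last exact: head.
move=> szm; rewrite /= !ntrs_cons ntr_nil mul1r /taus big_cons /tau /= mul1r expr0 mul1r.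
exact: IHps.
Qed.

(** * Moments of quadratic forms *)

(** The vector [a] is indexed by [None] and [b_k] by [Some k]. *)
Definition vector_index (u : option 'I_d) (al : 'I_N) : I :=
  if u is Some k then inr (inr (k, al)) else inl al.

Definition vector_variance (u : option 'I_d) : R :=
  if u is Some _ then sb ^+ 2 else sa ^+ 2.

Definition weight_vector (u : option 'I_d) : 'cV[T]_N :=
  \col_al X (vector_index u al).

Definition nform (u : option 'I_d) (w : seq letter) (v : option 'I_d) : T :=
  N%:R^-1 *: ((weight_vector u)^T *m word_matrix w *m weight_vector v) 0 0.

Lemma vector_index_eq u al v be :
  (vector_index u al == vector_index v be) = (v == u) && (be == al).
Proof.
by case: u v => [k|] [l|] //=; rewrite [LHS]eq_sym.
Qed.

Lemma variance_vector_index u al :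
  weight_variance (vector_index u al) = vector_variance u.
Proof. by case: u. Qed.

Lemma dmx_vector u al v : dmx (vector_index u al) (weight_vector v) =
  (v == u)%:R *: delta_mx al 0.
Proof.
apply/matrixP => be j; rewrite !mxE DX vector_index_eq ord1 eqxx andbT.
by case: (v == u); rewrite ?mul1r ?mul0r.
Qed.

Lemma dmx_vector_word u al w : dmx (vector_index u al) (word_matrix w) = 0.
Proof.
rewrite dmx_word big1 // => p _; rewrite (_ : dmx _ _ = 0) ?mulmx0 ?mul0mx //.
apply/matrixP => a b; rewrite /letter_matrix; case: ifP => _; rewrite !mxE DX.
  by case: u.
by case: u.
Qed.

Lemma D_vector_ntrs u al ws : D (vector_index u al) (ntrs ws) = 0.
Proof.
elim: ws => [|w ws IH]; first by rewrite /ntrs big_nil D1.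
rewrite ntrs_cons DM IH mulr0 addr0 D_ntr dmx_vector_word.
by rewrite mxtrace0 scaler0 mul0r.
Qed.

(** Integrate by parts the entries of the left vector: paired with the right vector it
closes the word into a trace, otherwise it differentiates [F]. *)
Lemma E_nform_step u w v F : E (nform u w v * F) = vector_variance u *
  ((v == u)%:R * E (ntr w * F) +
   N%:R^-1 * \sum_al E ((word_matrix w *m weight_vector v) al 0 *
                        D (vector_index u al) F)).
Proof.
rewrite /nform -mulmxA mxE -scalerAl EZ mulr_suml E_sum.
transitivity (N%:R^-1 * \sum_al vector_variance u * ((v == u)%:R * E (word_matrix w al al * F) +
   E ((word_matrix w *m weight_vector v) al 0 * D (vector_index u al) F))).
  congr (_ * _); apply: eq_bigr => al _.
  rewrite [_^T _ _]mxE [weight_vector _ _ _]mxE -mulrA Stein variance_vector_index; congr (_ * _).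
  rewrite DM ED; congr (_ + _).
  have /matrixP/(_ al 0) := dmx_mul (vector_index u al) (word_matrix w) (weight_vector v).
  rewrite dmx_vector_word mul0mx add0r dmx_vector -scalemxAr [LHS]mxE => ->.
  rewrite mxE -colE mxE -mulrA -scale_bool EZ.
  by [].
rewrite -mulr_sumr mulrCA; congr (_ * _); rewrite big_split mulrDr; congr (_ + _).
rewrite -mulr_sumr mulrCA; congr (_ * _).
by rewrite -E_sum -EZ -mulr_suml scalerAl.
Qed.

Lemma E_nform_ntrs u w v ws : E (nform u w v * ntrs ws) =
  vector_variance u * ((v == u)%:R * E (ntrs (w :: ws))).
Proof.
rewrite E_nform_step big1 ?mulr0 ?addr0 ?ntrs_cons // => al _.
by rewrite D_vector_ntrs mulr0 E0.
Qed.

Lemma D_nform u al u' w v :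
  D (vector_index u al) (nform u' w v) = N%:R^-1 *:
    ((u' == u)%:R * (word_matrix w *m weight_vector v) al 0 +
     (v == u)%:R * ((weight_vector u')^T *m word_matrix w) 0 al).
Proof.
rewrite /nform linearZ /=; congr (_ *: _).
have /matrixP/(_ 0 0) := dmx_mul (vector_index u al)
   ((weight_vector u')^T *m word_matrix w) (weight_vector v).
rewrite [LHS]mxE => ->; rewrite dmx_mul dmx_vector_word mulmx0 addr0 dmx_vector.
rewrite -map_trmx dmx_vector linearZ /= -!scalemxAl -scalemxAr trmx_delta.
by rewrite -mulmxA -rowE -colE !mxE.
Qed.

(** The left vector of the first form is paired either with its own right vector or with
one of the two vectors of the second form; in the last two cases the forms merge
into one, at the price of [N^-1]. *)
Lemma E_nform2 u w v u' w' v' : E (nform u w v * nform u' w' v') =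
  vector_variance u *
  ((v == u)%:R * E (nform u' w' v' * ntrs [:: w]) +
   N%:R^-1 * ((u' == u)%:R * E (nform v (transpose_word w ++ w') v' * ntrs [::]) +
              (v' == u)%:R * E (nform u' (w' ++ w) v * ntrs [::]))).
Proof.
rewrite E_nform_step /ntrs big_nil big_seq1 !mulr1 [ntr w * _]mulrC.
congr (_ * (_ + _ * _)); rewrite -E_sum -!EZ -ED; congr E.
under eq_bigr do rewrite D_nform -scalerAr.
rewrite -scaler_sumr /nform.
have sc (c : bool) (x : T) : (c%:R : R) *: ((N%:R^-1 : R) *: x) = N%:R^-1 *: (c%:R * x).
  by rewrite -scale_bool !scalerA mulrC.
rewrite !sc -scalerDr; congr (_ *: _).
under eq_bigr do rewrite mulrDr !(mulrCA _ _%:R).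
rewrite big_split /= -!mulr_sumr; congr (_ * _ + _ * _).
  rewrite word_matrix_cat word_matrix_transpose !mulmxA -trmx_mul -mulmxA mxE.
  by apply: eq_bigr => al _; rewrite [_^T _ _]mxE.
rewrite word_matrix_cat !mulmxA -(mulmxA _ _ (weight_vector v)) [RHS]mxE.
by apply: eq_bigr => al _; rewrite mulrC.
Qed.

(** The word between the two vectors in the inner product of [A_I z] and [A_J z']. *)
Definition word_pair (I J : seq 'I_d) : seq letter :=
  transpose_word (map (pair false) I) ++ map (pair false) J.

(** A cyclic rotation brings the plain letters in front of the transposed ones. *)
Lemma ntr_word_pair I J : ntr (word_pair I J) = ntr (pair_word (J, rev I)).
Proof.
rewrite /word_pair ntr_catC /pair_word; congr (ntr (_ ++ _)).
by rewrite /transpose_word map_rev -map_comp.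
Qed.

Lemma size_word_pair I J : size (word_pair I J) = (size I + size J)%N.
Proof. by rewrite size_cat size_transpose_word !size_map. Qed.

Lemma E_word_pair I J : `|E (ntrs [:: word_pair I J]) - (J == I)%:R * sA ^+ (size I + size J)|
  <= N%:R^-1 * word_bound (size I + size J).
Proof.
have := E_ntrs_pair_words [:: (J, rev I)].
rewrite /ntrs /= !big_seq1 -ntr_word_pair /taus big_seq1 /tau /= revK size_rev.
by rewrite /total_size /= size_pair_word /= size_rev addn0 addnC.
Qed.

Lemma E_word_pair2 I J I' J' :
  `|E (ntrs [:: word_pair I J; word_pair I' J'])
    - (J == I)%:R * sA ^+ (size I + size J) * ((J' == I')%:R * sA ^+ (size I' + size J'))|
  <= N%:R^-1 * word_bound (size I + size J + (size I' + size J')).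
Proof.
have := E_ntrs_pair_words [:: (J, rev I); (J', rev I')].
rewrite /ntrs /= !big_cons !big_nil -!ntr_word_pair /taus !big_cons big_nil /tau /=.
rewrite !revK !size_rev !mulr1 /total_size /= !size_pair_word /= !size_rev addn0.
by rewrite (addnC (size J)) (addnC (size J')).
Qed.

Implicit Types p r : seq 'I_d * option 'I_d.

Definition qform p r : T := nform p.2 (word_pair p.1 r.1) r.2.

(** The limit of the mean of [qform p r], which vanishes unless [p = r]. *)
Definition qlimit p r : R := vector_variance p.2 * ((r.2 == p.2)%:R *
  ((r.1 == p.1)%:R * sA ^+ (size p.1 + size r.1))).

Let s : R := sa ^+ 2 + sb ^+ 2.

Let s_ge0 : 0 <= s. Proof. by rewrite addr_ge0 ?sqr_ge0. Qed.

Let variance_ge0 u : 0 <= vector_variance u.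
Proof. by case: u => [k|] /=; rewrite sqr_ge0. Qed.

Let variance_le u : vector_variance u <= s.
Proof. by case: u => [k|]; rewrite /s /= ?lerDl ?lerDr sqr_ge0. Qed.

Lemma norm_bool_le (c : bool) (x y : R) : `|x| <= y -> `|c%:R * x| <= y.
Proof.
by case: c => xy; rewrite ?mul1r // mul0r normr0 (le_trans _ xy).
Qed.

Lemma norm_variance_le u (x y : R) : `|x| <= y -> `|vector_variance u * x| <= s * y.
Proof. by move=> xy; rewrite normrM ger0_norm // ler_pM. Qed.

Lemma E_qform p r : `|E (qform p r) - qlimit p r|
  <= s * (N%:R^-1 * word_bound (size p.1 + size r.1)).
Proof.
rewrite -[qform p r]mulr1 -[1](_ : ntrs [::] = 1); last by rewrite /ntrs big_nil.
rewrite E_nform_ntrs -mulrBr -mulrBr; apply: norm_variance_le; apply: norm_bool_le.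
exact: E_word_pair.
Qed.

Lemma E_nform_le u w v : `|E (nform u w v * ntrs [::])| <= s * word_bound (size w).
Proof.
rewrite E_nform_ntrs; apply: norm_variance_le; apply: norm_bool_le.
by have := E_ntrs_le [:: w]; rewrite /total_size /= addn0.
Qed.

Lemma E_qform2 p r p' r' : `|E (qform p r * qform p' r') - qlimit p r * qlimit p' r'|
  <= 3 * s ^+ 2 * (N%:R^-1 *
       word_bound (size p.1 + size r.1 + (size p'.1 + size r'.1))).
Proof.
set n := (_ + _ + _)%N.
rewrite E_nform2 E_nform_ntrs /qlimit -mulrA -mulrBr.
rewrite (_ : 3 * s ^+ 2 * _ = s * (s * (N%:R^-1 * word_bound n) +
   N%:R^-1 * (s * word_bound n + s * word_bound n))); last by ring.
apply: norm_variance_le.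
rewrite addrAC; apply: (le_trans (ler_normD _ _)); apply: lerD; last first.
  rewrite normrM ger0_norm //; apply: ler_wpM2l => //.
  apply: (le_trans (ler_normD _ _)); apply: lerD; apply: norm_bool_le.
    have := E_nform_le r.2 (transpose_word (word_pair p.1 r.1) ++ word_pair p'.1 r'.1) r'.2.
    by rewrite size_cat size_transpose_word !size_word_pair.
  have := E_nform_le p'.2 (word_pair p'.1 r'.1 ++ word_pair p.1 r.1) r.2.
  by rewrite size_cat !size_word_pair addnC.
rewrite -mulrA -mulrBr; apply: norm_bool_le.
rewrite [X in _ - X]mulrCA -mulrBr; apply: norm_variance_le.
rewrite [X in _ - X]mulrCA -mulrBr; apply: norm_bool_le.
have := E_word_pair2 p'.1 r'.1 p.1 r.1.
by rewrite [X in E _ - X]mulrC [X in word_bound X]addnC.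
Qed.

Let h (p : seq 'I_d * option 'I_d) := root_factorial_weight sA (size p.1).

(** Expand the product of centred forms as the error of the second moment ([E_qform2])
minus the errors of the two means ([E_qform]) times the limits, which have size [s *
(h p * h r)]: this gives the factor [3 + 1 + 1]. *)
Lemma covariance_qform p r p' r' :
  `|E ((qform p r - (qlimit p r)%:A) * (qform p' r' - (qlimit p' r')%:A))|
  <= 5 * s ^+ 2 / N%:R * (h p * h r * (h p' * h r')).
Proof.
have h_ge q : sA ^+ size q.1 <= h q by apply: root_factorial_weight_ge.
have h0 q : 0 <= h q by apply: le_trans (h_ge q); apply: exprn_ge0.
have limit_le q q' : `|qlimit q q'| <= s * (h q * h q').
  rewrite norm_variance_le //; do 2!apply: norm_bool_le.
  by rewrite ger0_norm ?exprn_ge0 // exprD ler_pM // exprn_ge0.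
have bound_le q q' : word_bound (size q.1 + size q'.1) <= h q * h q'.
  have := @root_factorial_split R sA (size q.1) (size q'.1) 0 0 sA_ge0.
  by rewrite !addn0 /root_factorial_weight expr0 fact0 sqrtr1 !mulr1.
have := root_factorial_split (size p.1) (size r.1) (size p'.1) (size r'.1) sA_ge0.
rewrite -/(h p) -/(h r) -/(h p') -/(h r') => bound4_le.
set q := qform p r; set q' := qform p' r'; set l := qlimit p r; set l' := qlimit p' r'.
have -> : E ((q - l%:A) * (q' - l'%:A)) =
  (E (q * q') - l * l') + (- l * (E q' - l') + - l' * (E q - l)).
  have -> : (q - l%:A) * (q' - l'%:A) = q * q' + (- l) *: q' + (- l') *: q + (l * l') *: 1.
    rewrite !scaleNr -scalerA -!(mulr_algl _ q) -!(mulr_algl _ q').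
    rewrite -(mulr_algl l (l' *: 1)); ring.
  by rewrite !ED !EZ E1; ring.
apply: (le_trans (ler_normD _ _)).
rewrite (_ : 5 * s ^+ 2 / N%:R * _ =
  3 * s ^+ 2 * (N%:R^-1 * (h p * h r * (h p' * h r'))) +
  (s * (h p * h r) * (s * (N%:R^-1 * (h p' * h r'))) +
   s * (h p' * h r') * (s * (N%:R^-1 * (h p * h r))))); last by ring.
have centered q1 q2 : `|E (qform q1 q2) - qlimit q1 q2| <= s * (N%:R^-1 * (h q1 * h q2)).
  by apply: (le_trans (E_qform _ _)); rewrite !ler_wpM2l.
apply: lerD; last apply: (le_trans (ler_normD _ _)); last apply: lerD.
- apply: (le_trans (E_qform2 _ _ _ _)); apply: ler_wpM2l.
    by rewrite mulr_ge0 ?sqr_ge0.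
  by rewrite ler_wpM2l.
- by rewrite normrM normrN; apply: ler_pM; rewrite ?normr_ge0 //; first [exact: limit_le | exact: centered].
- by rewrite normrM normrN; apply: ler_pM; rewrite ?normr_ge0 //; first [exact: limit_le | exact: centered].
Qed.

Variables (L : seq (seq 'I_d * option 'I_d)) (cx cy : seq 'I_d * option 'I_d -> R).

(** The covariance bound has one factor for each of the four words, so the sum of these
bounds over quadruples of words is a product of four sums. *)
Lemma E_square_sum_qform (Z := \sum_(p <- L) \sum_(r <- L) (cx p * cy r) *: qform p r)
    (K := \sum_(p <- L) \sum_(r <- L) cx p * cy r * qlimit p r) :
  E ((Z - K%:A) ^+ 2) <= 5 * s ^+ 2 / N%:R *
    ((\sum_(p <- L) `|cx p| * h p) ^+ 2 * (\sum_(p <- L) `|cy p| * h p) ^+ 2).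
Proof.
pose c i := cx i.1 * cy i.2; pose Y i := qform i.1 i.2 - (qlimit i.1 i.2)%:A.
pose H i := `|c i| * (h i.1 * h i.2).
have hE : (\sum_(p <- L) `|cx p| * h p) * (\sum_(p <- L) `|cy p| * h p) =
    \sum_(i <- allpairs pair L L) H i.
  rewrite big_allpairs mulr_suml; apply: eq_bigr => p _.
  by rewrite mulr_sumr; apply: eq_bigr => r _; rewrite /H /c normrM mulrACA.
have -> : Z - K%:A = \sum_(i <- allpairs pair L L) c i *: Y i.
  rewrite /Z /K big_allpairs scaler_suml -sumrB; apply: eq_bigr => p _.
  rewrite scaler_suml -sumrB; apply: eq_bigr => r _.
  by rewrite /c /Y /= scalerBr -(scalerA (cx p * cy r)).
rewrite -exprMn hE [X in E X]expr2 mulr_suml E_sum [X in _ * X]expr2 mulr_suml mulr_sumr.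
apply: ler_sum => i _; rewrite mulr_sumr E_sum !mulr_sumr; apply: ler_sum => j _.
rewrite -scalerAl -scalerAr !EZ; apply: (le_trans (ler_norm _)).
rewrite [leRHS](_ : _ = `|c i * c j| *
  (5 * s ^+ 2 / N%:R * (h i.1 * h i.2 * (h j.1 * h j.2)))); last first.
  by rewrite /H (normrM (c i) (c j)); ring.
rewrite [X in `|X|]mulrA normrM; apply: ler_wpM2l => //.
exact: covariance_qform.
Qed.

End Trace.

(** * Integrals of products of independent variables *)

Section IndicatorTransfer.
Import HBNNSimple.
Context {R : realType} {d : measure_display} {T : measurableType d}.

Lemma ge0_integral_simple_mul d1 (T1 : measurableType d1)
    (m : {measure set T1 -> \bar R}) (X : T1 -> T)
    (h : T1 -> R) (f : {nnsfun T >-> R}) :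
  measurable_fun setT X -> measurable_fun setT h -> (forall w, 0 <= h w) ->
  (\int[m]_w (f (X w) * h w)%:E =
   \sum_(y \in range f) y%:E * \int[m]_w (\1_(f @^-1` [set y]) (X w) * h w)%:E)%E.
Proof.
move=> mX mh h0.
have mI y : measurable_fun setT (fun w => \1_(f @^-1` [set y]) (X w) * h w).
  apply: measurable_funM => //.
  by apply: measurableT_comp.
have ge0 y : y \in range f -> 0 <= y by rewrite inE => -[x _ <-].
transitivity (\int[m]_w (\sum_(y \in range f)
   (y%:E * (\1_(f @^-1` [set y]) (X w) * h w)%:E)))%E.
  apply: eq_integral => w _; rewrite fimfunE EFinM -fsumEFin// ge0_mule_fsuml.
    by apply: eq_fsbigr => y _; rewrite !EFinM muleA.
  by move=> r; rewrite EFinM nnfun_muleindic_ge0.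
rewrite ge0_integral_fsum//=; last 2 first.
- by move=> y; apply/measurable_EFinP; apply: measurable_funM.
- move=> y w _; rewrite -EFinM lee_fin mulrA mulr_ge0 //.
  by rewrite -lee_fin EFinM nnfun_muleindic_ge0.
apply: eq_fsbigr => y yf.
rewrite ge0_integralZl_EFin//.
- by move=> w _; rewrite lee_fin mulr_ge0.
- exact/measurable_EFinP.
- exact: ge0.
Qed.

(** Integrals which agree on indicator functions agree on simple functions by linearity
and on nonnegative ones by monotone convergence. It serves both to pass from a law
to its density and to extend the product rule for independent variables from
indicators to functions. *)
Lemma ge0_integral_transfer d1 d2 (T1 : measurableType d1) (T2 : measurableType d2)
    (m1 : {measure set T1 -> \bar R}) (m2 : {measure set T2 -> \bar R})
    (X : T1 -> T) (Y : T2 -> T) (h : T1 -> R) (k : T2 -> R) :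
  measurable_fun setT X -> measurable_fun setT Y ->
  measurable_fun setT h -> measurable_fun setT k ->
  (forall w, 0 <= h w) -> (forall w, 0 <= k w) ->
  (forall B, measurable B -> \int[m1]_w (\1_B (X w) * h w)%:E =
                             \int[m2]_w (\1_B (Y w) * k w)%:E)%E ->
  forall f : T -> R, measurable_fun setT f -> (forall x, 0 <= f x) ->
  (\int[m1]_w (f (X w) * h w)%:E = \int[m2]_w (f (Y w) * k w)%:E)%E.
Proof.
move=> mX mY mh mk h0 k0 indic f mf f0.
have mEf : measurable_fun setT (EFin \o f) by exact/measurable_EFinP.
pose f_ := nnsfun_approx measurableT mEf.
have lim d' (T' : measurableType d') (m : {measure set T' -> \bar R})
    (Z : T' -> T) (g : T' -> R) : measurable_fun setT Z ->
    measurable_fun setT g -> (forall w, 0 <= g w) ->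
    (\int[m]_w (f (Z w) * g w)%:E = limn (fun n => \int[m]_w (f_ n (Z w) * g w)%:E))%E.
  move=> mZ mg g0; rewrite -monotone_convergence//=.
  - apply: eq_integral => w _; apply/esym/cvg_lim => //=.
    under eq_fun do rewrite EFinM; rewrite EFinM.
    apply: cvgeZr => //.
    by apply: cvg_nnsfun_approx => // x _; rewrite lee_fin.
  - move=> n; apply/measurable_EFinP; apply: measurable_funM => //.
    by apply: measurableT_comp.
  - by move=> n w _; rewrite lee_fin mulr_ge0.
  - move=> w _ a b ab; rewrite lee_fin ler_wpM2r //.
    exact/lefP/nd_nnsfun_approx.
rewrite !lim//; congr (limn _); apply/funext => n.
rewrite !ge0_integral_simple_mul//; apply: eq_fsbigr => y _.
by rewrite indic.
Qed.
End IndicatorTransfer.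

Lemma measurable_bigprod d (T : measurableType d) (R : realType) (J : Type) (s : seq J)
    (Q : pred J) (F : J -> T -> R) :
  (forall j, measurable_fun setT (F j)) ->
  measurable_fun setT (fun w => \prod_(j <- s | Q j) F j w).
Proof.
move=> mF; elim: s => [|j s IH].
  by under eq_fun do rewrite big_nil; exact: measurable_cst.
under eq_fun do rewrite big_cons; case: (Q j) => //.
exact: measurable_funM.
Qed.

Section Independence.
Context {disp : measure_display} {Omega : measurableType disp} {R : realType}.
Variable P : probability Omega R.
Variables (I : finType) (X : I -> {RV P >-> R}).

Let mean i (f : R -> R) : R := fine (\int[P]_w (f (X i w))%:E)%E.

Definition integrable_at i (f : R -> R) : Prop :=
  measurable_fun [set: R] f /\ P.-integrable setT (fun w => (f (X i w))%:E).

Definition update (f : I -> R -> R) j g i := if i == j then g else f i.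

Let measurable_comp i (f : R -> R) : measurable_fun [set: R] f ->
  measurable_fun setT (fun w => f (X i w)).
Proof. by move=> mf; apply: measurableT_comp. Qed.

Let measurable_prod_comp (Q : pred I) (f : I -> R -> R) :
  (forall i, measurable_fun [set: R] (f i)) ->
  measurable_fun setT (fun w => \prod_(i | Q i) f i (X i w)).
Proof. by move=> mf; apply: measurable_bigprod => i; apply: measurable_comp. Qed.

Let integrable_indic_at i B : measurable B -> integrable_at i \1_B.
Proof.
move=> mB; split => //; apply: measurable_bounded_integrable => //=.
- by rewrite probability_setT ltry.
- exact: measurable_comp.
- exists 1; split => // M M1 w _ /=; rewrite (le_trans _ (ltW M1)) // indicE.
  by rewrite ger0_norm // lern1 leq_b1.
Qed.

Let meanE i f : integrable_at i f ->
  (\int[P]_w (f (X i w))%:E)%E = (mean i f)%:E.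
Proof. by move=> [_ fi]; rewrite fineK //; apply: integrable_fin_num. Qed.

Hypothesis indepX : mutually_independent X.

Lemma integral_prod_indic (B : I -> set R) : (forall i, measurable (B i)) ->
  (\int[P]_w (\prod_i \1_(B i) (X i w))%:E = (\prod_i mean i \1_(B i))%:E)%E.
Proof.
move=> mB; have := indepX [set: I]%SET mB; set S := [set w | _] => PS.
have SE : S = \bigcap_(i in [set: I]) (X i @^-1` B i).
  by apply/seteqP; split => w /= Bw i; [move=> _; apply: Bw|move=> _; apply: Bw].
have mS : measurable S.
  rewrite SE; apply: fin_bigcap_measurable => [|i _]; first exact: finite_finset.
  by rewrite -[X in measurable X]setTI; apply: measurable_funP.
have -> : (\int[P]_w (\prod_i \1_(B i) (X i w))%:E = \int[P]_w (\1_S w)%:E)%E.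
  apply: eq_integral => w _; congr (_%:E); rewrite indicE.
  have [wS|wS] := boolP (w \in S).
    apply: big1 => i _; rewrite indicE mem_set //.
    by move: wS; rewrite inE; apply.
  have [i Bi] : exists i, ~ B i (X i w).
    apply/existsNP => Bw; move/negP: wS; apply; rewrite inE => i _; exact: Bw.
  by rewrite (bigD1 i) //= indicE memNset // mul0r.
rewrite integral_indic // setIT [LHS]PS.
rewrite (big_morph EFin EFinM erefl).
apply: eq_big => [i|i _]; first by rewrite inE.
rewrite -meanE; last exact: integrable_indic_at.
transitivity (\int[P]_w (\1_(X i @^-1` B i) w)%:E)%E; last by [].
rewrite integral_indic ?setIT //.
by rewrite -[X in measurable X]setTI; apply: measurable_funP.
Qed.

(** Independence is the case of indicator functions. The factors with index in [r] are
generalized to nonnegative functions one after the other, the other factors playing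
the role of a density in [ge0_integral_transfer]. *)
Lemma ge0_integral_prod (r : seq I) (f : I -> R -> R) : uniq r ->
  (forall i, integrable_at i (f i)) -> (forall i x, 0 <= f i x) ->
  (forall i, i \notin r -> exists2 B, measurable B & f i = \1_B) ->
  (\int[P]_w (\prod_i f i (X i w))%:E = (\prod_i mean i (f i))%:E)%E.
Proof.
elim: r f => [|j r IH] f.
  move=> _ _ _ fB.
  have {}fB i : {B | measurable B & f i = \1_B} by apply: cid2; apply: fB.
  have fE i : f i = \1_(s2val (fB i)) by case: (fB i).
  under eq_integral do under eq_bigr do rewrite fE.
  under [in RHS]eq_bigr do rewrite fE.
  by apply: integral_prod_indic => i; apply: (s2valP (fB i)).
move=> /= /andP[jr ur] fi f0 fB.
(* the factor [j] is freed: the other factors form the density [h] *)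
pose h w := \prod_(i | i != j) f i (X i w).
pose c := \prod_(i | i != j) mean i (f i).
have c0 : 0 <= c.
  by apply: prodr_ge0 => i _; apply: fine_ge0; apply: integral_ge0 => w _; rewrite lee_fin.
have h0 w : 0 <= h w by apply: prodr_ge0.
have splitE g w : \prod_i update f j g i (X i w) = g (X j w) * h w.
  rewrite (bigD1 j) //= /update eqxx; congr (_ * _).
  by apply: eq_bigr => i /negbTE ->.
have meanM g : integrable_at j g -> (forall x, 0 <= g x) ->
    (\int[P]_w (g (X j w) * c)%:E = (mean j g * c)%:E)%E.
  move=> gi g0; under eq_integral do rewrite EFinM.
  by rewrite integralZr //; [rewrite meanE // EFinM|case: gi].
have -> : (\int[P]_w (\prod_i f i (X i w))%:E = \int[P]_w (f j (X j w) * h w)%:E)%E.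
  by apply: eq_integral => w _; rewrite (bigD1 j).
rewrite (@ge0_integral_transfer _ _ _ _ _ _ _ P P (X j) (X j) h (cst c)) //=.
- by rewrite meanM // (bigD1 j).
- by apply: measurable_prod_comp => i; case: (fi i).
- move=> B mB; have iB := integrable_indic_at j mB.
  rewrite meanM //.
  under eq_integral do rewrite -splitE.
  rewrite IH //.
  + rewrite (bigD1 j) //= {1}/update eqxx; congr (_ * _)%:E.
    by apply: eq_bigr => i /negbTE ij; rewrite /update ij.
  + by move=> i; rewrite /update; case: eqP => [->|].
  + by move=> i x; rewrite /update; case: eqP => // _; rewrite indicE.
  + move=> i ir; rewrite /update; case: eqP => [_|/eqP ij]; first by exists B.
    by apply: fB; rewrite inE negb_or ij.
- by case: (fi j).
Qed.

Lemma integrable_prod (f : I -> R -> R) : (forall i, integrable_at i (f i)) ->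
  P.-integrable setT (fun w => (\prod_i f i (X i w))%:E).
Proof.
move=> fi; apply/integrableP; split.
  by apply/measurable_EFinP; apply: measurable_prod_comp => i; case: (fi i).
have := @ge0_integral_prod (enum I) (fun i x => `|f i x|) (enum_uniq _).
under eq_integral do rewrite -normr_prod.
move=> -> //; first exact: ltry.
  by move=> i; have [mf fI] := fi i; split; [exact: measurableT_comp|exact: integrable_norm].
by move=> i; rewrite mem_enum.
Qed.

(** The factors with index in [r] may change sign; they are split one after the other
into positive and negative parts. *)
Lemma integral_prod (r : seq I) (f : I -> R -> R) : uniq r ->
  (forall i, integrable_at i (f i)) ->
  (forall i, i \notin r -> forall x, 0 <= f i x) ->
  (\int[P]_w (\prod_i f i (X i w))%:E = (\prod_i mean i (f i))%:E)%E.
Proof.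
elim: r f => [|j r IH] f.
  move=> _ fi f0; apply: (ge0_integral_prod (enum_uniq I)) => // [i x|i].
    exact: f0.
  by rewrite mem_enum.
move=> /= /andP[jr ur] fi f0.
have [mfj fjI] := fi j.
have iP : integrable_at j (f j)^\+ by split; [exact: measurable_funrpos|exact: integrable_funrpos].
have iN : integrable_at j (f j)^\- by split; [exact: measurable_funrneg|exact: integrable_funrneg].
have fE x : f j x = (f j)^\+ x - (f j)^\- x by rewrite -[in LHS](funrposBneg (f j)).
have ri g : integrable_at j g -> forall i, integrable_at i (update f j g i).
  by move=> gi i; rewrite /update; case: eqP => [->|].
have IHr g : integrable_at j g -> (forall x, 0 <= g x) ->
    (\int[P]_w (\prod_i update f j g i (X i w))%:E =
       (mean j g * \prod_(i | i != j) mean i (f i))%:E)%E.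
  move=> gi g0; rewrite IH //.
  - rewrite (bigD1 j) //= {1}/update eqxx; congr (_ * _)%:E.
    by apply: eq_bigr => i /negbTE ij; rewrite /update ij.
  - exact: ri.
  - move=> i ir x; rewrite /update; case: eqP => // /eqP ij.
    by apply: f0; rewrite inE negb_or ij.
have splitE w : \prod_i f i (X i w) = \prod_i update f j (f j)^\+ i (X i w)
    - \prod_i update f j (f j)^\- i (X i w).
  rewrite [LHS](bigD1 j) //= [X in _ = X - _](bigD1 j) //= [X in _ = _ - X](bigD1 j) //=.
  rewrite /update eqxx.
  under [X in _ = _ * X - _]eq_bigr => i /negbTE -> do [].
  under [X in _ = _ - _ * X]eq_bigr => i /negbTE -> do [].
  by rewrite -mulrBl -fE.
under eq_integral do rewrite splitE EFinB.
rewrite integralB //=; [|exact: integrable_prod (ri _ iP)|exact: integrable_prod (ri _ iN)].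
rewrite !IHr //.
rewrite -EFinB -mulrBl [in RHS](bigD1 j) //=; congr (_ * _)%:E.
apply: EFin_inj; rewrite EFinB -!meanE // -integralB //=; [|by case: iP|by case: iN].
by apply: eq_integral => w _; rewrite -EFinB -fE.
Qed.

End Independence.

(** * Gaussian moments *)

Section GaussianDensity.
Variables (R : realType) (s : R).
Hypothesis s_gt0 : 0 < s.
Local Notation mu := (@lebesgue_measure R).
Local Notation phi := (normal_pdf 0 s).
Local Notation psi := (normal_pdf 0 (Num.sqrt 2 * s)).

Let s0 : s != 0. Proof. exact: lt0r_neq0. Qed.
Let t_gt0 : 0 < Num.sqrt 2 * s. Proof. by rewrite mulr_gt0 ?sqrtr_gt0. Qed.
Let t0 : Num.sqrt 2 * s != 0. Proof. exact: lt0r_neq0. Qed.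

Let phiE x : phi x = normal_peak s * expR (- x ^+ 2 / (s ^+ 2 *+ 2)).
Proof. by rewrite normal_pdfE // /normal_fun subr0. Qed.

Lemma power_le_expR (u : R) n : 0 <= u -> u ^+ n <= n%:R ^+ n * expR u.
Proof.
move=> u0; case: n => [|n]; first by rewrite !expr0 mul1r -expR0 ler_expR.
have n0 : n.+1%:R != 0 :> R by [].
have : u / n.+1%:R <= expR (u / n.+1%:R).
  by rewrite (le_trans _ (expR_ge1Dx _)) // lerDr.
rewrite ler_pdivrMr ?ltr0n // => un.
rewrite (le_trans (lerXn2r _ _ _ un)) ?nnegrE // ?mulr_ge0 ?expR_ge0 //.
by rewrite exprMn mulrC -expRM_natl [_ * (u / _)]mulrC divfK.
Qed.

(** Half of the exponent of the density absorbs the power; the remaining half is the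
density of the normal law with twice the variance. *)
Lemma power_mul_normal_pdf_le n :
  exists2 C, 0 <= C & forall x, `|x| ^+ n * phi x <= C * psi x.
Proof.
pose C := 1 + (4 * s ^+ 2) ^+ n * n%:R ^+ n.
have s2 : 0 <= 4 * s ^+ 2 by rewrite mulr_ge0 ?sqr_ge0.
have C0 : 0 <= C.
  by apply: addr_ge0 => //; apply: mulr_ge0; apply: exprn_ge0.
exists (C * normal_peak s / normal_peak (Num.sqrt 2 * s)).
  by rewrite divr_ge0 ?normal_peak_ge0 ?mulr_ge0 ?normal_peak_ge0.
move=> x; rewrite phiE (normal_pdfE _ t0) /normal_fun subr0 [leRHS]mulrA divfK; last first.
  exact/lt0r_neq0/normal_peak_gt0.
(* [u] is half of the exponent of the density *)
pose u := x ^+ 2 / (4 * s ^+ 2).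
have u0 : 0 <= u by rewrite divr_ge0 ?sqr_ge0.
have -> : - x ^+ 2 / (s ^+ 2 *+ 2) = - u - u by rewrite /u; field.
have -> : - x ^+ 2 / ((Num.sqrt 2 * s) ^+ 2 *+ 2) = - u.
  by rewrite exprMn sqr_sqrtr // /u; field.
rewrite expRD !mulrA ler_pM2r ?expR_gt0 // mulrAC ler_wpM2r ?normal_peak_ge0 //.
rewrite expRN ler_pdivrMr ?expR_gt0 //.
have xn : `|x| ^+ n <= 1 + (x ^+ 2) ^+ n.
  have [x1|x1] := leP `|x| 1.
    by rewrite (le_trans (exprn_ile1 _ _ x1)) // lerDl exprn_ge0 ?sqr_ge0.
  rewrite -real_normK ?num_real // -exprM mulnC exprM.
  rewrite (le_trans _ (_ : (`|x| ^+ n) ^+ 2 <= _)) //; last by rewrite lerDr.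
  by rewrite expr2 ler_peMr ?exprn_ge0 // exprn_ege1 // ltW.
apply: (le_trans xn); rewrite mulrDl mul1r lerD //.
  by rewrite -expR0 ler_expR.
have -> : x ^+ 2 = 4 * s ^+ 2 * u by rewrite /u; field.
by rewrite exprMn -mulrA ler_wpM2l ?power_le_expR // exprn_ge0.
Qed.

Lemma integrable_power_normal_pdf n :
  mu.-integrable setT (fun x => (x ^+ n * phi x)%:E).
Proof.
have [C C0 HC] := power_mul_normal_pdf_le n.
have := integrableZl measurableT C (integrable_normal_pdf 0 (Num.sqrt 2 * s)).
apply: le_integrable => //=.
  apply/measurable_EFinP; apply: measurable_funM; last exact: measurable_normal_pdf.
  exact: measurable_funX.
move=> x _; rewrite lee_fin normrM normrX [`|phi x|]ger0_norm ?normal_pdf_ge0 //.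
by rewrite [leRHS]ger0_norm ?mulr_ge0 ?normal_pdf_ge0.
Qed.

Lemma is_derive_power_normal_pdf n (x : R) :
  is_derive x 1 (fun x => x ^+ n * phi x)
    (n%:R * (x ^+ n.-1 * phi x) - s ^- 2 * (x ^+ n.+1 * phi x)).
Proof.
pose k : R := - (s ^+ 2 *+ 2)^-1.
pose g : R -> R := k \*: (id ^+ 2).
have dg : is_derive x 1 g (k *: ((2%:R * x ^+ 1) *: 1)) by apply: is_deriveZ.
have de : is_derive x 1 (expR \o g) (expR (g x) * (k *: ((2%:R * x ^+ 1) *: 1))).
  exact: is_derive1_comp.
have dp : is_derive x 1 (normal_peak s \*: (expR \o g))
  (normal_peak s *: (expR (g x) * (k *: ((2%:R * x ^+ 1) *: 1)))) by apply: is_deriveZ.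
have phig y : phi y = (normal_peak s \*: (expR \o g)) y.
  by rewrite phiE /g /k /= /GRing.scale /= !mulNr [_ / _]mulrC.
have -> : (fun x => x ^+ n * phi x) =
   (id ^+ n) * (normal_peak s \*: (expR \o g)).
  by apply/funext => y; rewrite phig mulrfctE exprfctE.
apply: is_derive_eq; rewrite !phig /= exprfctE /k.
have scE (a b : R) : a *: (b : R^o) = a * b by [].
rewrite !scE ![x ^+ _.+1]exprS expr0; by field.
Qed.

Lemma power_normal_pdf_le_inv n :
  exists2 C, 0 <= C & forall x, x != 0 -> `|x ^+ n * phi x| <= C / `|x|.
Proof.
have [C C0 HC] := power_mul_normal_pdf_le n.+1.
exists (C * normal_peak (Num.sqrt 2 * s)).
  by rewrite mulr_ge0 ?normal_peak_ge0.
move=> x x0; rewrite ler_pdivlMr ?normr_gt0 // normrM normrX.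
rewrite [`|phi x|]ger0_norm ?normal_pdf_ge0 // mulrAC -exprSr (le_trans (HC x)) //.
by rewrite ler_wpM2l // normal_pdf_ub.
Qed.

Let dF n (x : R) := n%:R * (x ^+ n.-1 * phi x) - s ^- 2 * (x ^+ n.+1 * phi x).

Let integrable_dF n : mu.-integrable setT (fun x => (dF n x)%:E).
Proof.
rewrite /dF; under eq_fun do rewrite EFinB !EFinM.
by apply: integrableB => //; apply: integrableZl => //; apply: integrable_power_normal_pdf.
Qed.

Let integral_dF_itv n m :
  (\int[mu]_(x in `[(- m.+1%:R)%R, (m.+1%:R)%R]) (dF n x)%:E =
    (m.+1%:R ^+ n * phi m.+1%:R - (- m.+1%:R) ^+ n * phi (- m.+1%:R))%R%:E)%E.
Proof.
have dpow := is_derive_power_normal_pdf n.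
have cont k : continuous (fun x : R => x ^+ k * phi x).
  move=> x; apply: cvgM; first exact: exprn_continuous.
  exact: continuous_normal_pdf.
rewrite (@continuous_FTC2 _ _ (fun x => x ^+ n * phi x)) -?EFinB //.
- by rewrite gtrN.
- apply: continuous_subspaceT => x; apply: cvgB; apply: cvgM; try exact: cvg_cst; exact: cont.
- split => [x _||].
  + by have [] := dpow x.
  + exact/cvg_at_right_filter/cont.
  + exact/cvg_at_left_filter/cont.
- by move=> x _; rewrite derive1E; have [_ ->] := dpow x.
Qed.

Let integral_dF n : (\int[mu]_x (dF n x)%:E = 0)%E.
Proof.
pose D m : set R := [set` `[- m.+1%:R, m.+1%:R]%R].
have mdF : measurable_fun [set: R] (dF n).
  by apply/measurable_EFinP; have /measurable_int := integrable_dF n.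
have [] := @dominated_convergence _ _ _ mu setT measurableT
  (fun m x => ((dF n \_ (D m)) x)%:E) (fun x => (dF n x)%:E)
  (fun x => (`|dF n x|)%:E).
- move=> m; apply/measurable_EFinP; apply/(measurable_restrictT _ _).1.
    exact: measurable_itv.
  exact: measurable_funTS.
- exact/measurable_EFinP.
- apply: aeW => /= x _; apply: cvg_near_cst; exists (Num.bound `|x : R|) => // m /= xm.
  rewrite patchE mem_set //.
  rewrite /D /= in_itv /= -ler_norml ltW // (lt_le_trans (archi_boundP _)) //.
  by rewrite ler_nat (leq_trans xm).
- exact: (integrable_norm (integrable_dF n)).
- apply: aeW => x m _; rewrite lee_fin patchE; case: ifP => //= _.
  by rewrite normr0.
move=> _ _ /=.
have [C C0 HC] := power_normal_pdf_le_inv n.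
have intD m : (\int[mu]_x ((dF n \_ (D m)) x)%:E =
    (m.+1%:R ^+ n * phi m.+1%:R - (- m.+1%:R) ^+ n * phi (- m.+1%:R))%R%:E)%E.
  rewrite -integral_dF_itv [in RHS]integral_mkcond; apply: eq_integral => x _.
  by rewrite restrict_EFin.
under eq_fun do rewrite intD.
move=> cvg1.
suff cvg0 : (EFin \o (fun m : nat =>
      m.+1%:R ^+ n * phi m.+1%:R - (- m.+1%:R) ^+ n * phi (- m.+1%:R)))
    @ \oo --> 0%E.
  by apply: (cvg_unique _ cvg1 cvg0).
apply: cvg_EFin; first exact: nearW.
apply/norm_cvg0P.
apply: (@squeeze_cvgr _ _ _ _ (cst 0) (fun m : nat => (C *+ 2) * (m.+1%:R)^-1)).
- apply: nearW => m; rewrite normr_ge0 /= (le_trans (ler_normB _ _)) //.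
  rewrite mulrnAl mulr2n lerD //.
    by rewrite (le_trans (HC _ _)) // ger0_norm.
  by rewrite (le_trans (HC _ _)) ?oppr_eq0 // normrN ger0_norm.
- exact: cvg_cst.
- rewrite -[X in _ --> X](mulr0 (C *+ 2)); apply: cvgM; first exact: cvg_cst.
  exact: cvg_harmonic.
Qed.

(** The derivative [dF n] of [x ^+ n * phi x] has integral zero, since this function
vanishes at infinity: this is integration by parts for the function [x ^+ n]. *)
Lemma normal_pdf_moment n : \int[mu]_x (x ^+ n.+1 * phi x) =
  s ^+ 2 * (n%:R * \int[mu]_x (x ^+ n.-1 * phi x)).
Proof.
have iZ k c : mu.-integrable setT (fun x => (c * (x ^+ k * phi x))%:E).
  under eq_fun do rewrite EFinM.
  by apply: integrableZl => //; apply: integrable_power_normal_pdf.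
have : \int[mu]_x dF n x = 0 by rewrite /Rintegral integral_dF.
rewrite /dF RintegralB //; [|exact: iZ|exact: iZ].
rewrite !RintegralZl //; [|exact: integrable_power_normal_pdf..].
move/eqP; rewrite subr_eq0 => /eqP ->.
by rewrite mulrA mulfV ?mul1r // expf_neq0.
Qed.
End GaussianDensity.

Section GaussianMoments.
Context {disp : measure_display} {Omega : measurableType disp} {R : realType}.
Variable P : probability Omega R.
Local Notation mu := (@lebesgue_measure R).

Section LawTransfer.
Variables (X : {RV P >-> R}) (d : measure_display) (T : measurableType d)
  (m : {measure set T -> \bar R}) (Y : T -> R) (k : T -> R).
Hypotheses (mY : measurable_fun setT Y) (mk : measurable_fun setT k)
  (k0 : forall t, 0 <= k t).
Hypothesis law : forall B : set R, measurable B ->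
  (P (X @^-1` B) = \int[m]_t (\1_B (Y t) * k t)%:E)%E.

Let ge0_law (f : R -> R) : measurable_fun [set: R] f -> (forall x, 0 <= f x) ->
  (\int[P]_w (f (X w))%:E = \int[m]_t (f (Y t) * k t)%:E)%E.
Proof.
move=> mf f0.
transitivity (\int[P]_w (f (X w) * 1)%:E)%E.
  by apply: eq_integral => w _; rewrite mulr1.
apply: (ge0_integral_transfer _ mY _ mk) => // B mB.
rewrite -law //; transitivity (\int[P]_w (\1_(X @^-1` B) w)%:E)%E.
  by apply: eq_integral => w _; rewrite mulr1.
rewrite integral_indic ?setIT //.
by rewrite -[X in measurable X]setTI; apply: measurable_funP.
Qed.

Lemma integral_law (f : R -> R) : measurable_fun [set: R] f ->
  m.-integrable setT (fun t => (f (Y t) * k t)%:E) ->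
  P.-integrable setT (fun w => (f (X w))%:E) /\
  \int[P]_w f (X w) = \int[m]_t (f (Y t) * k t).
Proof.
move=> mf fi; split.
  apply/integrableP; split; first by apply/measurable_EFinP; apply: measurableT_comp.
  rewrite (ge0_law (f := fun x => `|f x|)) //; last exact: measurableT_comp.
  have /integrableP[_] := fi; rewrite /=; congr (_ < _)%E.
  by apply: eq_integral => t _; rewrite /= normrM [`|k t|]ger0_norm.
have maxM (x y : R) : 0 <= y -> Num.max x 0 * y = Num.max (x * y) 0.
  move=> y0; have [x0|x0] := leP x 0.
    by rewrite mul0r max_r // mulr_le0_ge0.
  by rewrite max_l // mulr_ge0 // ltW.
have posE (g : R -> R) t : (g^\+ (Y t) * k t)%:E = (fun t => (g (Y t) * k t)%:E)^\+%E t.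
  by rewrite funeposE -EFin_max -maxM.
have negE (g : R -> R) t : (g^\- (Y t) * k t)%:E = (fun t => (g (Y t) * k t)%:E)^\-%E t.
  by rewrite funenegE -EFinN -EFin_max -mulNr -maxM.
rewrite /Rintegral integralE [in RHS]integralE; congr (fine (_ - _)%E).
  transitivity (\int[P]_w (f^\+ (X w))%:E)%E.
    by apply: eq_integral => w _; rewrite funeposE -EFin_max.
  rewrite ge0_law //; last exact: measurable_funrpos.
  by apply: eq_integral => t _; rewrite posE.
transitivity (\int[P]_w (f^\- (X w))%:E)%E.
  by apply: eq_integral => w _; rewrite funenegE -EFinN -EFin_max.
rewrite ge0_law //; last exact: measurable_funrneg.
by apply: eq_integral => t _; rewrite negE.
Qed.
End LawTransfer.

(** The recursion on moments holds for the degenerate law as well, where the variable is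
almost surely [0]; there the integral against the density is replaced by one against
the Dirac measure. *)
Lemma normal_law_moment (X : {RV P >-> R}) v : 0 <= v -> has_normal_law X 0 v ->
  (forall n, P.-integrable setT (fun w => (X w ^+ n)%:E)) /\
  (forall n, \int[P]_w (X w ^+ n.+1) = v * (n%:R * \int[P]_w (X w ^+ n.-1))).
Proof.
move=> v0 law; have [v_gt0|v_le0] := ltP 0 v; last first.
  have {v0 v_le0} vE : v = 0 by apply/eqP; rewrite eq_le v0 v_le0.
  have H n : P.-integrable setT (fun w => (X w ^+ n)%:E) /\
      \int[P]_w (X w ^+ n) = \int[\d_(0 : R)]_t (t ^+ n * 1).
    apply: (@integral_law X _ _ (\d_(0 : R)) id (cst 1) _ _ _ _ (fun x => x ^+ n)) => //.
    - move=> B mB; rewrite -[LHS]/(distribution P X B) law // /normal_law vE eqxx.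
      rewrite integral_dirac //; last first.
        by apply/measurable_EFinP; apply: measurable_funM => //; apply: measurable_indic.
      by rewrite diracT mul1e mulr1 diracE indicE.
    - apply/integrableP; split.
        apply/measurable_EFinP; by apply: measurable_funM => //; apply: measurable_funX.
      rewrite integral_dirac //; last first.
        apply/measurable_EFinP; apply: measurableT_comp => //.
        by apply: measurable_funM => //; apply: measurable_funX.
      by rewrite diracT mul1e ltry.
  have Hn n : \int[P]_w (X w ^+ n) = 0 ^+ n.
    rewrite (H n).2 /Rintegral integral_dirac //=; last first.
      by apply/measurable_EFinP; apply: measurable_funM => //; apply: measurable_funX.
    by rewrite indicE mem_set // mul1r mulr1.
  by split=> n; [case: (H n)|rewrite Hn vE mul0r expr0n].
have s_gt0 : 0 < Num.sqrt v by rewrite sqrtr_gt0.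
have H n : P.-integrable setT (fun w => (X w ^+ n)%:E) /\
    \int[P]_w (X w ^+ n) = \int[mu]_t (t ^+ n * normal_pdf 0 (Num.sqrt v) t).
  apply: (@integral_law X _ _ mu id (normal_pdf 0 (Num.sqrt v)) _ _ _ _ (fun x => x ^+ n)) => //.
  - exact: measurable_normal_pdf.
  - by move=> t; apply: normal_pdf_ge0.
  - move=> B mB; rewrite -[LHS]/(distribution P X B) law // /normal_law gt_eqF //.
    rewrite /normal_prob [LHS]integral_mkcond; apply: eq_integral => t _.
    by rewrite restrict_EFin /= patchE indicE; case: ifP => _; rewrite ?mul1r ?mul0r.
  - exact: integrable_power_normal_pdf.
split=> n; first by case: (H n).
by rewrite !(H _).2 normal_pdf_moment // sqr_sqrtr.
Qed.
End GaussianMoments.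

(** * Means of polynomials in independent Gaussian variables *)

Section GaussianPolynomials.
Context {disp : measure_display} {Omega : measurableType disp} {R : realType}.
Variable P : probability Omega R.
Variables (I : finType) (X : I -> {RV P >-> R}) (v : I -> R).
Hypothesis v_ge0 : forall i, 0 <= v i.
Hypothesis lawX : forall i, has_normal_law (X i) 0 (v i).
Hypothesis indepX : mutually_independent X.

Local Notation T := (mpoly #|I| R).

Definition poly_eval (w : Omega) : T -> R := meval (fun j => X (enum_val j) w).

Definition poly_var (i : I) : T := mpolyX R (mnm1 (enum_rank i)).

Definition poly_mean (p : T) : R := \int[P]_w poly_eval w p.

Lemma poly_eval_var w i : poly_eval w (poly_var i) = X i w.
Proof. by rewrite /poly_eval mevalXU enum_rankK. Qed.

Let moment i n := \int[P]_w (X i w ^+ n).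

Lemma poly_eval_monomial w (m : multinom #|I|) :
  poly_eval w (mpolyX R m) = \prod_i X i w ^+ m (enum_rank i).
Proof.
rewrite /poly_eval mevalX (reindex (@enum_rank I)) /=; last first.
  by exists (@enum_val I xpredT) => ? _; rewrite ?enum_rankK ?enum_valK.
by apply: eq_bigr => i _; rewrite enum_rankK.
Qed.

Let integrable_at_power i n : integrable_at X i (fun x => x ^+ n).
Proof.
by split; [exact: measurable_funX|case: (normal_law_moment (v_ge0 i) (lawX i))].
Qed.

Lemma poly_mean_monomial m :
  poly_mean (mpolyX R m) = \prod_i moment i (m (enum_rank i)).
Proof.
rewrite /poly_mean; under eq_Rintegral do rewrite poly_eval_monomial.
rewrite /Rintegral (integral_prod indepX (enum_uniq I) (f := fun i x => x ^+ m (enum_rank i))) //.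
by move=> i; rewrite mem_enum.
Qed.

Lemma integrable_poly_eval p : P.-integrable setT (fun w => (poly_eval w p)%:E).
Proof.
have -> : (fun w => (poly_eval w p)%:E) = (fun w => \sum_(m <- msupp p)
    ((mcoeff m p)%:E * (poly_eval w (mpolyX R m))%:E)%E).
  apply/funext => w; under [RHS]eq_bigr do rewrite -EFinM.
  rewrite sumEFin; congr (_%:E); rewrite {1}(mpolyE p) /poly_eval raddf_sum.
  by apply: eq_bigr => m _; rewrite /= mevalZ.
apply: integrable_sum => // m _; apply: integrableZl => //.
under eq_fun do rewrite poly_eval_monomial.
by apply: (integrable_prod indepX (f := fun i x => x ^+ m (enum_rank i))).
Qed.

Lemma poly_mean1 : poly_mean 1 = 1.
Proof.
rewrite /poly_mean; under eq_Rintegral do rewrite /poly_eval rmorph1.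
by rewrite Rintegral_cst // mul1r -[RHS]/(fine 1%E); congr fine; apply: probability_setT.
Qed.

Lemma poly_meanD p q : poly_mean (p + q) = poly_mean p + poly_mean q.
Proof.
rewrite /poly_mean; under eq_Rintegral do rewrite /poly_eval mevalD.
by rewrite RintegralD //; apply: integrable_poly_eval.
Qed.

Lemma poly_meanZ c p : poly_mean (c *: p) = c * poly_mean p.
Proof.
rewrite /poly_mean; under eq_Rintegral do rewrite /poly_eval mevalZ.
by rewrite RintegralZl //; apply: integrable_poly_eval.
Qed.

Lemma poly_mean_sum (J : Type) (r : seq J) (F : J -> T) :
  poly_mean (\sum_(j <- r) F j) = \sum_(j <- r) poly_mean (F j).
Proof.
apply: (big_morph poly_mean poly_meanD).
by rewrite -(scale0r (0 : T)) poly_meanZ mul0r.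
Qed.

(** By linearity it is enough to consider a monomial; its mean is the product of the
moments of the variables, and only the exponent of the variable [i] changes. *)
Lemma poly_mean_stein i p :
  poly_mean (poly_var i * p) = v i * poly_mean (mderiv (enum_rank i) p).
Proof.
rewrite (mpolyE p) mulr_sumr raddf_sum !poly_mean_sum mulr_sumr.
apply: eq_bigr => m _; rewrite /= mderivZ -scalerAr !poly_meanZ mulrCA; congr (_ * _).
rewrite mderivX poly_meanZ /poly_var -mpolyXD !poly_mean_monomial.
rewrite (bigD1 i) //= [in RHS](bigD1 i) //= mnmDE mnmBE mnm1E eqxx add1n subn1.
rewrite /moment (normal_law_moment (v_ge0 i) (lawX i)).2 -!mulrA.
congr (_ * (_ * (_ * _))); apply: eq_bigr => j ji.
by rewrite mnmDE mnmBE mnm1E (inj_eq enum_rank_inj) eq_sym (negbTE ji) add0n subn0.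
Qed.

Lemma mderiv_var i j : mderiv (enum_rank i) (poly_var j) = (i == j)%:R.
Proof.
rewrite /poly_var mderivX mnm1E (inj_eq enum_rank_inj) eq_sym.
case: eqP => [->|_]; last by rewrite scale0r.
have -> : mnm_sub (mnm1 (enum_rank j)) (mnm1 (enum_rank j)) = mnm0.
  by apply/mnmP => k; rewrite mnmBE subnn mnm0E.
by rewrite mpolyX0 scale1r.
Qed.
End GaussianPolynomials.

(** * Bilinear forms in sampled words *)

Lemma inner_sum (R : realType) n (J : Type) (L L' : seq J) (c c' : J -> R)
    (u u' : J -> 'cV[R]_n) :
  inner (\sum_(p <- L) c p *: u p) (\sum_(r <- L') c' r *: u' r) =
  \sum_(p <- L) \sum_(r <- L') c p * c' r * inner (u p) (u' r).
Proof.
rewrite /inner; under eq_bigr do rewrite !summxE mulr_suml.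
rewrite exchange_big; apply: eq_bigr => p _ /=.
under eq_bigr do rewrite mulr_sumr.
rewrite exchange_big; apply: eq_bigr => r _ /=.
by rewrite mulr_sumr; apply: eq_bigr => i _; rewrite !mxE mulrACA.
Qed.

Section RandomForms.
Context {disp : measure_display} {Omega : measurableType disp} {R : realType}.
Variable P : probability Omega R.
Variables (N d : nat) (sa sA sb : R).
Hypothesis N_gt0 : (0 < N)%N.
Hypothesis sA_ge0 : 0 <= sA.
Variables (a : 'I_N -> {RV P >-> R}) (A : 'I_d -> 'I_N -> 'I_N -> {RV P >-> R})
  (b : 'I_d -> 'I_N -> {RV P >-> R}).
Hypothesis gw : gaussian_weights sa sA sb a A b.
Implicit Types p r : seq 'I_d * option 'I_d.

Definition sample_matrix (w : Omega) (k : 'I_d) : 'M[R]_N :=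
  \matrix_(al, be) A k al be w.

Definition sample_vector (w : Omega) (u : option 'I_d) : 'cV[R]_N :=
  \col_al (if u is Some k then b k al w else a al w).

Definition sample_word (w : Omega) p : 'cV[R]_N :=
  foldr (fun k z => sample_matrix w k *m z) (sample_vector w p.2) p.1.

Local Notation I := (('I_N + ('I_d * 'I_N * 'I_N + 'I_d * 'I_N))%type : finType).
Local Notation X := (entries a A b).
Local Notation T := (mpoly #|I| R).
Local Notation var := (@weight_variance R N d sa sA sb).
Local Notation Q := (@qform R T N d (@poly_var R I)).

Let var_ge0 i : 0 <= var i.
Proof. by case: i => [al|[[[k al] be]|[k al]]] /=; rewrite ?divr_ge0 ?sqr_ge0. Qed.

Let lawX i : has_normal_law (X i) 0 (var i).
Proof. by case: gw => la lA lb _; case: i => [al|[[[k al] be]|[k al]]] /=. Qed.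

Let indepX : mutually_independent X.
Proof. by case: gw. Qed.

Let ev w : T -> R := poly_eval X w.

Let ev_matrix w k : map_mx (ev w) (weight_matrix (@poly_var R I) k) = sample_matrix w k.
Proof. by apply/matrixP => al be; rewrite !mxE /ev poly_eval_var. Qed.

Let ev_vector w u : map_mx (ev w) (weight_vector (@poly_var R I) u) = sample_vector w u.
Proof.
by apply/matrixP => al be; rewrite !mxE /ev poly_eval_var; case: u.
Qed.

Let ev_word w (J : seq 'I_d) u :
  map_mx (ev w) (word_matrix (@poly_var R I) (map (pair false) J)
                 *m weight_vector (@poly_var R I) u) = sample_word w (J, u).
Proof.
elim: J => [|k J IH]; first by rewrite /= mul1mx ev_vector.
rewrite [map_mx _ _](_ : _ = sample_matrix w k *m sample_word w (J, u)) // -IH -ev_matrix.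
by rewrite -map_mxM mulmxA.
Qed.

Lemma eval_qform w p r : ev w (Q p r) =
  N%:R^-1 * inner (sample_word w p) (sample_word w r).
Proof.
case: p r => [J u] [J' u']; rewrite /qform /nform /ev /poly_eval mevalZ; congr (_ * _).
rewrite /word_pair word_matrix_cat word_matrix_transpose mulmxA -trmx_mul -mulmxA /=.
rewrite -!ev_word [X in meval _ X]mxE /inner raddf_sum; apply: eq_bigr => al _.
have mapE (M : 'cV[T]_N) : map_mx (ev w) M al 0 = ev w (M al 0) by rewrite mxE.
by rewrite !mapE [_^T _ _]mxE /= mevalM.
Qed.

(** The entries of the sampled matrices and vectors are the values of the variables of a
polynomial algebra on which the mean satisfies the integration by parts formula, so
[E_square_sum_qform] applies. *)
Lemma mean_square_forms (L : seq (seq 'I_d * option 'I_d))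
    (cx cy : seq 'I_d * option 'I_d -> R)
    (h := fun p : seq 'I_d * option 'I_d => root_factorial_weight sA (size p.1))
    (F := fun w => N%:R^-1 * inner (\sum_(p <- L) cx p *: sample_word w p)
                                   (\sum_(r <- L) cy r *: sample_word w r)
        - \sum_(p <- L) \sum_(r <- L) cx p * cy r * qlimit sa sA sb p r) :
  measurable_fun setT F /\
  (\int[P]_w (F w ^+ 2)%:E <= (5 * (sa ^+ 2 + sb ^+ 2) ^+ 2 / N%:R *
    ((\sum_(p <- L) `|cx p| * h p) ^+ 2 * (\sum_(p <- L) `|cy p| * h p) ^+ 2))%:E)%E.
Proof.
pose Z : T := \sum_(p <- L) \sum_(r <- L) (cx p * cy r) *: Q p r.
pose K := \sum_(p <- L) \sum_(r <- L) cx p * cy r * qlimit sa sA sb p r.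
have FE w : F w = ev w (Z - K%:A).
  rewrite /ev /poly_eval mevalB mevalZ meval1 mulr1 /F; congr (_ - _).
  rewrite /Z raddf_sum inner_sum mulr_sumr; apply: eq_bigr => p _ /=.
  rewrite raddf_sum mulr_sumr; apply: eq_bigr => r _ /=.
  by rewrite mevalZ -[meval _ _]/(ev w (Q p r)) eval_qform mulrCA.
have mF (q : T) : measurable_fun setT (fun w => ev w q).
  by apply/measurable_EFinP; have /measurable_int := integrable_poly_eval var_ge0 lawX indepX q.
split; first by rewrite (_ : F = fun w => ev w (Z - K%:A)) //; apply/funext.
have := E_square_sum_qform (X := @poly_var R I) (D := fun i => mderiv (enum_rank i))
  (E := poly_mean X) (sa := sa) (sA := sA) (sb := sb) N_gt0
  (fun i => mderivM (enum_rank i)) (@mderiv_var R I) (poly_mean1 X)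
  (poly_meanD var_ge0 lawX indepX) (poly_meanZ var_ge0 lawX indepX)
  (poly_mean_stein var_ge0 lawX indepX) sA_ge0 L cx cy.
cbv zeta; rewrite -lee_fin; apply: le_trans; rewrite /poly_mean /Rintegral fineK; last first.
  by apply: integrable_fin_num => //; apply: integrable_poly_eval.
rewrite le_eqVlt; apply/orP; left; apply/eqP; apply: eq_integral => w _.
by rewrite FE /ev /poly_eval rmorphXn.
Qed.
End RandomForms.

(** * Primitives on the unit interval *)

Section Primitives.
Context {R : realType}.
Local Notation mu := (@lebesgue_measure R).
Local Notation I01 := (`[0, 1]%classic : set R).
Implicit Types f g h : R -> R.

Definition continuous01 g := {within I01, continuous g}.

Definition integrable01 f := mu.-integrable I01 (EFin \o f).

Definition prim f t := \int[mu]_(r in `[0, t]) f r.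

Lemma sub_itv01 t : t \in `[0, 1]%R -> `[0, t]%classic `<=` I01.
Proof.
rewrite in_itv /= => /andP[_ t1] r; rewrite /= !in_itv /= => /andP[-> rt].
exact: le_trans rt t1.
Qed.

Lemma integrable01S f t : t \in `[0, 1]%R -> integrable01 f ->
  mu.-integrable `[0, t] (EFin \o f).
Proof. by move=> t01; apply: integrableS => //; apply: sub_itv01. Qed.

Lemma continuous01_measurable g : continuous01 g -> measurable_fun I01 g.
Proof. by apply: subspace_continuous_measurable_fun; apply: measurable_itv. Qed.

Lemma continuous01_bounded g : continuous01 g ->
  exists2 M, 0 <= M & forall r, r \in `[0, 1]%R -> `|g r| <= M.
Proof.
move=> cg; have /compact_bounded[M [_ HM]] : compact (g @` I01).
  by apply: continuous_compact => //; apply: segment_compact.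
exists (`|M| + 1); first by rewrite addr_ge0.
move=> r r01; apply: (HM (`|M| + 1)); last by exists r.
by rewrite (le_lt_trans (ler_norm M)) // ltrDl.
Qed.

Lemma integrable01_mul g f : continuous01 g -> integrable01 f ->
  integrable01 (fun r => g r * f r).
Proof.
move=> cg fi; have [M M0 HM] := continuous01_bounded cg.
have MfI : mu.-integrable I01 (fun r => (M%:E * (`|f r|)%:E)%E).
  by apply: integrableZl => //; apply: integrable_norm.
apply: le_integrable MfI => //.
  apply/measurable_EFinP; apply: measurable_funM; first exact: continuous01_measurable.
  by apply/measurable_EFinP; case/integrableP: fi.
move=> r r01 /=; rewrite lee_fin normrM normrM normr_id (ger0_norm M0).
by rewrite ler_wpM2r // HM.
Qed.

Lemma prim_continuous f : integrable01 f -> continuous01 (prim f).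
Proof. by move=> fi; apply: parameterized_integral_continuous. Qed.

Lemma eq_prim f g t : t \in `[0, 1]%R ->
  (forall r, r \in `[0, 1]%R -> f r = g r) -> prim f t = prim g t.
Proof.
move=> t01 fg; apply: eq_Rintegral => r; rewrite inE => rt.
by apply: fg; apply: (sub_itv01 t01 rt).
Qed.

Lemma primD f g t : t \in `[0, 1]%R -> integrable01 f -> integrable01 g ->
  prim (fun r => f r + g r) t = prim f t + prim g t.
Proof.
by move=> t01 fi gi; rewrite /prim RintegralD //; apply: integrable01S.
Qed.

Lemma primB f g t : t \in `[0, 1]%R -> integrable01 f -> integrable01 g ->
  prim (fun r => f r - g r) t = prim f t - prim g t.
Proof.
by move=> t01 fi gi; rewrite /prim RintegralB //; apply: integrable01S.
Qed.

Lemma primZ c f t : t \in `[0, 1]%R -> integrable01 f ->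
  prim (fun r => c * f r) t = c * prim f t.
Proof.
by move=> t01 fi; rewrite /prim RintegralZl //; apply: integrable01S.
Qed.

Lemma integrable01Z c f : integrable01 f -> integrable01 (fun r => c * f r).
Proof.
move=> fi; rewrite /integrable01 (_ : EFin \o _ = (fun r => c%:E * (f r)%:E)%E) //.
by apply: integrableZl.
Qed.

Lemma integrable01D f g : integrable01 f -> integrable01 g ->
  integrable01 (fun r => f r + g r).
Proof. by move=> fi gi; exact: (integrableD _ fi gi). Qed.

Lemma integrable01B f g : integrable01 f -> integrable01 g ->
  integrable01 (fun r => f r - g r).
Proof. by move=> fi gi; exact: (integrableB _ fi gi). Qed.

Lemma integrable01_sum (J : Type) (s : seq J) (F : J -> R -> R) :
  (forall j, integrable01 (F j)) -> integrable01 (fun r => \sum_(j <- s) F j r).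
Proof.
move=> Fi; rewrite /integrable01.
rewrite (_ : EFin \o _ = (fun r => \sum_(j <- s) (F j r)%:E)%E); last first.
  by apply/funext => r; rewrite sumEFin.
by apply: integrable_sum => // j _; apply: Fi.
Qed.

Lemma prim_sum (J : Type) (s : seq J) (F : J -> R -> R) t : t \in `[0, 1]%R ->
  (forall j, integrable01 (F j)) ->
  prim (fun r => \sum_(j <- s) F j r) t = \sum_(j <- s) prim (F j) t.
Proof.
move=> t01 Fi; elim: s => [|j s IH].
  rewrite big_nil -[RHS](mul0r (prim (cst 0) t)) /prim.
  under eq_Rintegral do rewrite big_nil.
  by rewrite Rintegral_cst // !mul0r.
rewrite big_cons -IH -primD //; last exact: integrable01_sum.
by apply: eq_prim => // r _; rewrite big_cons.
Qed.

Lemma integrable01_norm f : integrable01 f -> integrable01 (fun r => `|f r|).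
Proof. by move=> fi; apply: integrable_norm. Qed.

Lemma le_prim f g t : t \in `[0, 1]%R -> integrable01 f -> integrable01 g ->
  (forall r, r \in `[0, 1]%R -> f r <= g r) -> prim f t <= prim g t.
Proof.
move=> t01 fi gi fg; apply: le_Rintegral => //; [exact: integrable01S..|].
by move=> r rt; apply: fg; apply: (sub_itv01 t01 rt).
Qed.

Lemma norm_prim_le f t : t \in `[0, 1]%R -> integrable01 f ->
  `|prim f t| <= prim (fun r => `|f r|) t.
Proof. by move=> t01 fi; apply: le_normr_Rintegral => //; apply: integrable01S. Qed.

Lemma prim_ge0 f t : (forall r, 0 <= f r) -> 0 <= prim f t.
Proof. by move=> f0; apply: Rintegral_ge0 => r _. Qed.

End Primitives.

Section ProductRule.
Context {R : realType}.
Local Notation mu := (@lebesgue_measure R).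
Local Notation I01 := (`[0, 1]%classic : set R).
Implicit Types f g : R -> R.

Lemma restrict01_measurable f t : t \in `[0, 1]%R -> integrable01 f ->
  measurable_fun [set: R] (f \_ `[0, t]).
Proof.
move=> t01 fi; apply/(measurable_restrictT _ _).1; first exact: measurable_itv.
by have /measurable_int/measurable_EFinP := integrable01S t01 fi.
Qed.

(** Both sides are the integral of [f r * g r'] over the triangle [r < r' < t]. It plays
the part of the product rule [(FG)' = fG + Fg] for primitives of functions that are
merely integrable. *)
Lemma ge0_prim_mulB f g t : t \in `[0, 1]%R -> integrable01 f -> integrable01 g ->
  (forall r, 0 <= f r) -> (forall r, 0 <= g r) ->
  prim (fun r => f r * (prim g t - prim g r)) t = prim (fun r => prim f r * g r) t.
Proof.
move=> t01 fi gi f0 g0.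
have /andP[t0 t1] : 0 <= t <= 1 by move: t01; rewrite in_itv.
pose D : set R := `[0, t]%classic.
(* the triangle below the diagonal, as a subset of the square of side [t] *)
pose U : set (measurableTypeR R * measurableTypeR R) := [set p | (p.1 : R) < p.2].
pose h (p : measurableTypeR R * measurableTypeR R) : \bar R :=
  ((f \_ D) p.1 * (g \_ D) p.2 * \1_U p)%:E.
have mU : measurable U.
  have := @measurable_fun_ltr _ (measurableTypeR R * measurableTypeR R)%type R setT fst snd
    measurable_fst measurable_snd measurableT [set true] I.
  by rewrite setTI.
have mh : measurable_fun setT h.
  apply/measurable_EFinP; apply: measurable_funM; first apply: measurable_funM.
  - by apply: (measurableT_comp (restrict01_measurable t01 fi)); exact: measurable_fst.
  - by apply: (measurableT_comp (restrict01_measurable t01 gi)); exact: measurable_snd.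
  - exact: measurable_indic.
have patch0 (k : R -> R) r : (forall r, 0 <= k r) -> 0 <= (k \_ D) r.
  by move=> k0; rewrite patchE; case: ifP.
have h0 p : (0 <= h p)%E by rewrite lee_fin !mulr_ge0 // patch0.
have := @fubini_tonelli _ _ _ _ _ mu mu h mh h0.
have -> : (\int[mu]_x \int[mu]_y h (x, y))%E =
    (\int[mu]_(r in D) (f r * (prim g t - prim g r))%:E)%E.
  rewrite [RHS]integral_mkcond; apply: eq_integral => r _.
  rewrite patchE; case: ifPn => [/set_mem rD|rD]; last first.
    by rewrite integral0_eq // => y _; rewrite /h /= patchE (negbTE rD) !mul0r.
  have /andP[r0 rt] : 0 <= r <= t by move: rD; rewrite /D /= in_itv.
  rewrite /prim (Rintegral_itvB (integrable01S t01 gi)) ?bnd_simp //.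
  have gi' : mu.-integrable `]r, t] (EFin \o g).
    apply: integrableS (integrable01S t01 gi) => // y /=.
    by rewrite !in_itv /= => /andP[ry ->]; rewrite (le_trans r0) // ltW.
  rewrite EFinM [X in (_ * X)%E]fineK; last exact: integrable_fin_num.
  rewrite -integralZl // [RHS]integral_mkcond; apply: eq_integral => y _.
  rewrite /h /= [in RHS]patchE [X in (X * _ * _)%:E]patchE mem_set //.
  rewrite indicE; case: ifPn => [/set_mem|/negP yI].
    rewrite /= in_itv /= => /andP[ry yt].
    rewrite patchE mem_set; last by rewrite /D /= in_itv /= yt (le_trans r0) // ltW.
    by rewrite mem_set // mulr1 EFinM.
  rewrite patchE; case: ifP => [/set_mem yD|_]; last by rewrite mulr0 mul0r.
  rewrite memNset ?mulr0 // => ry; apply: yI; rewrite inE /= in_itv /= ry.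
  by move: yD; rewrite /D /= in_itv => /andP[].
have -> : (\int[mu]_y \int[mu]_x h (x, y))%E =
    (\int[mu]_(r in D) (prim f r * g r)%:E)%E.
  rewrite [RHS]integral_mkcond; apply: eq_integral => r _.
  rewrite patchE; case: ifPn => [/set_mem rD|rD]; last first.
    by rewrite integral0_eq // => y _; rewrite /h /= [X in _ * X * _]patchE (negbTE rD) mulr0 mul0r.
  have /andP[r0 rt] : 0 <= r <= t by move: rD; rewrite /D /= in_itv.
  have fi' : mu.-integrable `[0, r[ (EFin \o f).
    apply: integrableS (integrable01S t01 fi) => // y /=.
    by rewrite !in_itv /= => /andP[-> yr]; rewrite (le_trans (ltW yr)).
  rewrite /prim -(Rintegral_itv_bndo_bndc fi') mulrC.
  rewrite EFinM [X in (_ * X)%E]fineK; last exact: integrable_fin_num.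
  rewrite -integralZl // [RHS]integral_mkcond; apply: eq_integral => y _.
  rewrite /h /= [in RHS]patchE [X in (_ * X * _)%:E]patchE mem_set //.
  rewrite indicE; case: ifPn => [/set_mem|/negP yI].
    rewrite /= in_itv /= => /andP[y0 yr].
    rewrite patchE mem_set; last by rewrite /D /= in_itv /= y0 (le_trans (ltW yr)).
    by rewrite mem_set // mulr1 mulrC EFinM.
  rewrite patchE; case: ifP => [/set_mem yD|_]; last by rewrite !mul0r.
  rewrite memNset ?mulr0 // => yr; apply: yI; rewrite inE /= in_itv /= [y < r]yr andbT.
  by move: yD; rewrite /D /= in_itv => /andP[].
by rewrite /prim /Rintegral => ->.
Qed.
End ProductRule.

Section Continuous01.
Context {R : realType}.
Implicit Types f g : R -> R.

Lemma continuous01_cst (c : R) : continuous01 (fun _ : R => c).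
Proof. by move=> x; apply: cvg_cst. Qed.

Lemma continuous01D f g : continuous01 f -> continuous01 g ->
  continuous01 (fun r => f r + g r).
Proof. by move=> cf cg x; apply: cvgD; [exact: cf|exact: cg]. Qed.

Lemma continuous01B f g : continuous01 f -> continuous01 g ->
  continuous01 (fun r => f r - g r).
Proof. by move=> cf cg x; apply: cvgB; [exact: cf|exact: cg]. Qed.

Lemma continuous01M f g : continuous01 f -> continuous01 g ->
  continuous01 (fun r => f r * g r).
Proof. by move=> cf cg x; apply: cvgM; [exact: cf|exact: cg]. Qed.

Lemma continuous01X f n : continuous01 f -> continuous01 (fun r => f r ^+ n).
Proof.
move=> cf; elim: n => [|n IH].
  by under eq_fun do rewrite expr0; exact: continuous01_cst.
by under eq_fun do rewrite exprS; exact: continuous01M.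
Qed.

Lemma continuous01_sum (J : Type) (s : seq J) (F : J -> R -> R) :
  (forall j, continuous01 (F j)) -> continuous01 (fun r => \sum_(j <- s) F j r).
Proof.
move=> cF; elim: s => [|j s IH].
  by under eq_fun do rewrite big_nil; exact: continuous01_cst.
by under eq_fun do rewrite big_cons; exact: continuous01D.
Qed.

End Continuous01.

(** * Picard iteration along a path *)

Section Picard.
Context {R : realType} {d : nat}.
Variable v : 'I_d -> R -> R.
Hypothesis iv : forall k, integrable01 (v k).

Definition speed (r : R) : R := \sum_(k < d) `|v k r|.

(** The length of the path, for the norm of [R ^ d] that adds absolute values. *)
Definition travel (t : R) : R := prim speed t.

Lemma speed_ge0 r : 0 <= speed r.
Proof. by apply: sumr_ge0. Qed.

Lemma integrable01_speed : integrable01 speed.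
Proof. by apply: integrable01_sum => k; apply: integrable01_norm. Qed.

Lemma travel_ge0 t : 0 <= travel t.
Proof. by apply: prim_ge0 => r; apply: speed_ge0. Qed.

Lemma continuous01_travel : continuous01 travel.
Proof. by apply: prim_continuous; apply: integrable01_speed. Qed.

Lemma travel_le1 t : t \in `[0, 1]%R -> travel t <= travel 1.
Proof.
rewrite in_itv /= => /andP[t0 t1]; rewrite -subr_ge0 /travel /prim Rintegral_itvB ?bnd_simp //.
  by apply: Rintegral_ge0 => r _; apply: speed_ge0.
exact: integrable01_speed.
Qed.

Lemma integrable01_travel_pow m : integrable01 (fun r => travel r ^+ m * speed r).
Proof.
apply: integrable01_mul; last exact: integrable01_speed.
exact: continuous01X continuous01_travel.
Qed.

(** A power of [travel] is differentiated by induction with the product rule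
[ge0_prim_mulB], since [travel] need not be differentiable at any given time. *)
Lemma prim_travel_pow m t : t \in `[0, 1]%R ->
  prim (fun r => travel r ^+ m * speed r) t = travel t ^+ m.+1 / m.+1%:R.
Proof.
elim: m t => [|m IH] t t01.
  by rewrite divr1 expr1; apply: eq_prim => // r _; rewrite mul1r.
have g0 r : 0 <= travel r ^+ m * speed r.
  by rewrite mulr_ge0 ?speed_ge0 // exprn_ge0 // travel_ge0.
have := ge0_prim_mulB t01 integrable01_speed (integrable01_travel_pow m) speed_ge0 g0.
set G := prim (fun r => travel r ^+ m * speed r) t.
set Q := prim (fun r => travel r ^+ m.+1 * speed r) t.
have -> : prim (fun r => prim speed r * (travel r ^+ m * speed r)) t = Q.
  by apply: eq_prim => // r _; rewrite mulrA -exprS.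
have -> : prim (fun r => speed r * (G - prim (fun r => travel r ^+ m * speed r) r)) t =
    G * travel t - m.+1%:R^-1 * Q.
  rewrite -primZ //; last exact: integrable01_speed.
  rewrite -primZ //; last exact: integrable01_travel_pow.
  rewrite -primB //; last 2 first.
  - by apply: integrable01Z; apply: integrable01_speed.
  - by apply: integrable01Z; apply: integrable01_travel_pow.
  by apply: eq_prim => // r r01; rewrite IH //; ring.
rewrite /G IH // => /eqP; rewrite subr_eq => /eqP QE.
have m1 : m.+1%:R != 0 :> R by [].
have m2 : m.+2%:R != 0 :> R by [].
have -> : travel t ^+ m.+2 = m.+1%:R * (travel t ^+ m.+1 / m.+1%:R * travel t).
  by rewrite [travel t ^+ m.+2]exprSr; field.
rewrite QE mulrDr mulrA mulfV // mul1r.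
rewrite -[in LHS](mulfK m2 Q); congr (_ / _).
by rewrite -[m.+2]addn1 natrD; ring.
Qed.

Definition travel_bound m t := travel t ^+ m / m`!%:R.

(** One integration against the path increases by one the order of [travel_bound], which
is why the Picard iterates converge as an exponential series. *)
Lemma picard_step (J : Type) (s : seq J) (g : J -> 'I_d -> R -> R) c m t :
  (forall j k, continuous01 (g j k)) ->
  (forall k r, r \in `[0, 1]%R ->
     \sum_(j <- s) `|g j k r| <= c * travel_bound m r) ->
  t \in `[0, 1]%R ->
  \sum_(j <- s) \sum_(k < d) `|prim (fun r => g j k r * v k r) t|
    <= c * travel_bound m.+1 t.
Proof.
move=> cg gle t01.
have gi j k : integrable01 (fun r => g j k r * v k r) by apply: integrable01_mul.
apply: (@le_trans _ _ (\sum_(j <- s) \sum_(k < d) prim (fun r => `|g j k r * v k r|) t)).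
  by apply: ler_sum => j _; apply: ler_sum => k _; apply: norm_prim_le.
rewrite (eq_bigr (fun j => prim (fun r => \sum_(k < d) `|g j k r * v k r|) t)); last first.
  by move=> j _; rewrite prim_sum // => k; apply: integrable01_norm.
rewrite -prim_sum //; last first.
  by move=> j; apply: integrable01_sum => k; apply: integrable01_norm.
apply: (@le_trans _ _ (prim (fun r => c / m`!%:R * (travel r ^+ m * speed r)) t)).
  apply: le_prim => //.
  - apply: integrable01_sum => j; apply: integrable01_sum => k.
    exact: integrable01_norm.
  - by apply: integrable01Z; apply: integrable01_travel_pow.
  move=> r r01; rewrite exchange_big /= [leRHS]mulrA [leRHS]mulr_sumr.
  apply: ler_sum => k _; under eq_bigr do rewrite normrM.
  rewrite -mulr_suml ler_wpM2r // (le_trans (gle k r r01)) //.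
  by rewrite /travel_bound mulrAC mulrA.
rewrite primZ //; last exact: integrable01_travel_pow.
rewrite prim_travel_pow // /travel_bound factS natrM invfM.
by rewrite le_eqVlt; apply/orP; left; apply/eqP; ring.
Qed.

End Picard.

(** * Expansion of a linear controlled equation *)

Section IndexWords.
Variable d : nat.
Local Notation iword := (seq 'I_d * option 'I_d)%type.

Definition cons_word (k : 'I_d) (p : iword) : iword := (k :: p.1, p.2).

(** A word is a list of matrix indices together with the index of a vector, [None]
standing for [a] and [Some k] for [b_k]. The level counts the matrices; a word
ending with [b_k] has one more integral than its level. *)
Fixpoint level (j : nat) : seq iword :=
  if j is j'.+1 then [seq cons_word k p | k <- enum 'I_d, p <- level j']
  else ([::], None) :: [seq ([::], Some k) | k <- enum 'I_d].

Fixpoint upto (m : nat) : seq iword :=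
  if m is m'.+1 then upto m' ++ level m' else [::].

Lemma size_level j p : p \in level j -> size p.1 = j.
Proof.
elim: j p => [|j IH] p /=.
  by rewrite inE => /orP[/eqP ->//|/mapP[k _ ->]].
by move=> /allpairsP[[k q] /= [_ /IH <- ->]].
Qed.

Lemma size_upto m p : p \in upto m -> (size p.1 < m)%N.
Proof.
elim: m => //= m IH; rewrite mem_cat => /orP[/IH|/size_level ->] //.
by move=> /ltnW; rewrite ltnS.
Qed.

Lemma uniq_level j : uniq (level j).
Proof.
elim: j => [|j IH] /=.
  apply/andP; split; first by apply/negP => /mapP[].
  by rewrite map_inj_uniq ?enum_uniq // => k l [].
by apply: allpairs_uniq; rewrite ?enum_uniq // => -[k [I u]] [l [J w]] _ _ [-> -> ->].
Qed.

Lemma uniq_upto m : uniq (upto m).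
Proof.
elim: m => //= m IH; rewrite cat_uniq IH uniq_level andbT; apply/hasPn => p.
by move=> /size_level pm; apply/negP => /size_upto; rewrite pm ltnn.
Qed.

Section Sums.
Variables (V : nmodType) (F : iword -> V).

Lemma sum_level0 :
  \sum_(p <- level 0) F p = F ([::], None) + \sum_(k < d) F ([::], Some k).
Proof. by rewrite /= big_cons big_map big_enum. Qed.

Lemma sum_levelS j :
  \sum_(p <- level j.+1) F p = \sum_(k < d) \sum_(p <- level j) F (cons_word k p).
Proof. by rewrite /= big_allpairs_dep big_enum. Qed.

Lemma sum_upto m : \sum_(p <- upto m) F p = \sum_(j < m) \sum_(p <- level j) F p.
Proof.
elim: m => [|m IH]; first by rewrite big_nil big_ord0.
by rewrite /= big_cat IH big_ord_recr.
Qed.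
End Sums.

Lemma sum_uptoS (V : nmodType) (F : iword -> V) m :
  \sum_(p <- upto m.+1) F p = F ([::], None) + \sum_(k < d) F ([::], Some k) +
    \sum_(k < d) \sum_(p <- upto m) F (cons_word k p).
Proof.
rewrite sum_upto big_ord_recl sum_level0; congr (_ + _).
under eq_bigr do rewrite sum_levelS.
rewrite exchange_big; apply: eq_bigr => k _ /=.
by rewrite sum_upto.
Qed.

End IndexWords.

Section IteratedIntegrals.
Context {R : realType} {d : nat}.
Variable v : 'I_d -> R -> R.
Hypothesis iv : forall k, integrable01 (v k).
Local Notation iword := (seq 'I_d * option 'I_d)%type.

(** The outermost integral belongs to the first letter, which is also the leftmost
matrix of [word_vector]. *)
Definition iterated_integral (p : iword) : R -> R :=
  foldr (fun k f => prim (fun r => f r * v k r))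
    (if p.2 is Some k then prim (v k) else fun=> 1) p.1.

Lemma continuous01_iterated p : continuous01 (iterated_integral p).
Proof.
case: p => J u; elim: J => [|k J IH] /=.
  case: u => [k|]; first exact: prim_continuous.
  exact: continuous01_cst.
by apply: prim_continuous; apply: integrable01_mul.
Qed.

(** Each letter is one [picard_step], applied to the sum over all words of a level at
once. *)
Lemma sum_iterated_level_le j t : t \in `[0, 1]%R ->
  \sum_(p <- level d j) `|iterated_integral p t| <=
    (1 + travel v 1) * travel_bound v j t.
Proof.
elim: j t => [|j IH] t t01.
  rewrite sum_level0 /travel_bound expr0 fact0 divr1 mulr1 /iterated_integral /= normr1.
  rewrite lerD2l (le_trans _ (travel_le1 iv t01)) //.
  rewrite /travel /speed prim_sum //; last by move=> k; apply: integrable01_norm.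
  by apply: ler_sum => k _; apply: norm_prim_le.
rewrite sum_levelS exchange_big /=.
apply: (picard_step iv (g := fun p _ => iterated_integral p)) => //.
by move=> p _; apply: continuous01_iterated.
Qed.

End IteratedIntegrals.

Section Expansion.
Context {R : realType} {d N : nat}.
Variable v : 'I_d -> R -> R.
Hypothesis iv : forall k, integrable01 (v k).
Variables (A : 'I_d -> 'M[R]_N) (z : option 'I_d -> 'cV[R]_N) (S : R -> 'cV[R]_N).
Hypothesis cS : forall i, continuous01 (fun t => S t i 0).
Hypothesis eqS : forall t, t \in `[0, 1]%R -> forall i, S t i 0 =
  z None i 0 + \sum_(k < d) prim (fun r => (A k *m S r + z (Some k)) i 0 * v k r) t.
Local Notation iword := (seq 'I_d * option 'I_d)%type.

Definition word_vector (p : iword) : 'cV[R]_N :=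
  foldr (fun k y => A k *m y) (z p.2) p.1.

Definition expansion m t := \sum_(p <- upto d m) iterated_integral v p t *: word_vector p.

Definition remainder m t := S t - expansion m t.

Let continuous01_remainder m i : continuous01 (fun t => remainder m t i 0).
Proof.
under eq_fun do rewrite mxE [X in _ + X]mxE summxE.
apply: continuous01B => //; apply: continuous01_sum => p.
under eq_fun do rewrite mxE.
by apply: continuous01M; [exact: continuous01_iterated|exact: continuous01_cst].
Qed.

Let continuous01_mulmx (k : 'I_d) (f : R -> 'cV[R]_N) i :
  (forall j, continuous01 (fun t => f t j 0)) ->
  continuous01 (fun t => (A k *m f t) i 0).
Proof.
move=> cf; under eq_fun do rewrite mxE.
by apply: continuous01_sum => j; apply: continuous01M => //; exact: continuous01_cst.
Qed.

(** The expansions satisfy the integral equation with a shift of the order, so the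
remainders satisfy its linear part. *)
Lemma remainderS m t i : t \in `[0, 1]%R ->
  remainder m.+1 t i 0 = \sum_(k < d) prim (fun r => (A k *m remainder m r) i 0 * v k r) t.
Proof.
move=> t01.
have iAS k : integrable01 (fun r => (A k *m S r) i 0 * v k r).
  by apply: integrable01_mul => //; apply: continuous01_mulmx.
have iit p k : integrable01 (fun r => iterated_integral v p r * v k r).
  by apply: integrable01_mul => //; apply: continuous01_iterated.
have SE : S t i 0 = z None i 0 +
    \sum_(k < d) (prim (fun r => (A k *m S r) i 0 * v k r) t + z (Some k) i 0 * prim (v k) t).
  rewrite eqS //; congr (_ + _); apply: eq_bigr => k _.
  rewrite -primZ // -primD //; last exact: integrable01Z.
  by apply: eq_prim => // r _; rewrite mxE mulrDl.
have EE : expansion m.+1 t i 0 = z None i 0 + \sum_(k < d) z (Some k) i 0 * prim (v k) t +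
    \sum_(k < d) prim (fun r => (A k *m expansion m r) i 0 * v k r) t.
  rewrite /expansion sum_uptoS !mxE !summxE /= mul1r; congr (_ + _ + _).
    by apply: eq_bigr => k _; rewrite mxE mulrC.
  apply: eq_bigr => k _; rewrite summxE.
  transitivity (\sum_(p <- upto d m) prim (fun r =>
     (A k *m word_vector p) i 0 * (iterated_integral v p r * v k r)) t).
    by apply: eq_bigr => p _; rewrite mxE primZ // mulrC.
  rewrite -prim_sum //; last by move=> p; apply: integrable01Z.
  apply: eq_prim => // r _; rewrite mulmx_sumr summxE mulr_suml.
  by apply: eq_bigr => p _; rewrite -scalemxAr [X in _ = X * _]mxE; ring.
rewrite [LHS]mxE [X in _ + X]mxE SE EE big_split /=.
rewrite [X in _ = X](_ : _ = \sum_(k < d) (prim (fun r => (A k *m S r) i 0 * v k r) t -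
   prim (fun r => (A k *m expansion m r) i 0 * v k r) t)).
  by rewrite sumrB; ring.
apply: eq_bigr => k _; rewrite -primB //; last first.
  apply: integrable01_mul => //; apply: continuous01_mulmx => j.
  under eq_fun do rewrite summxE; apply: continuous01_sum => p.
  under eq_fun do rewrite mxE.
  by apply: continuous01M; [exact: continuous01_iterated|exact: continuous01_cst].
by apply: eq_prim => // r _; rewrite mulmxBr mxE [X in _ + X]mxE mulrBl.
Qed.

Let Lam : R := \sum_(k < d) \sum_(i < N) \sum_(j < N) `|A k i j|.

Lemma norm_mulmx_le k (y : 'cV[R]_N) :
  \sum_(i < N) `|(A k *m y) i 0| <= Lam * \sum_(i < N) `|y i 0|.
Proof.
apply: (@le_trans _ _ ((\sum_(i < N) \sum_(j < N) `|A k i j|) * \sum_(i < N) `|y i 0|)).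
  rewrite mulr_suml; apply: ler_sum => i _; rewrite mxE.
  apply: (le_trans (ler_norm_sum _ _ _)); rewrite mulr_suml; apply: ler_sum => j _.
  rewrite normrM ler_wpM2l // (bigD1 j) //= lerDl.
  exact: sumr_ge0.
rewrite ler_wpM2r ?sumr_ge0 // /Lam [leRHS](bigD1 k) //= lerDl.
by do 3!apply: sumr_ge0 => ? _.
Qed.

(** Picard iteration of [remainderS] from a bound on the continuous function [S]; [Lam]
bounds the norm of every matrix [A k]. *)
Lemma remainder_le : exists2 M, 0 <= M & forall m t, t \in `[0, 1]%R ->
  \sum_(i < N) `|remainder m t i 0| <= M * Lam ^+ m * travel_bound v m t.
Proof.
have HM i : {M | 0 <= M & forall t, t \in `[0, 1]%R -> `|S t i 0| <= M}.
  by apply: cid2; apply: (continuous01_bounded (g := fun t => S t i 0)).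
pose M i := s2val (HM i).
have M0 i : 0 <= M i by rewrite /M; case: (HM i).
have SM i t : t \in `[0, 1]%R -> `|S t i 0| <= M i by rewrite /M; case: (HM i) => /= B _; apply.
exists (\sum_i M i); first exact: sumr_ge0.
elim=> [|m IH] t t01.
  rewrite /travel_bound !expr0 fact0 divr1 !mulr1; apply: ler_sum => i _.
  by rewrite /remainder /expansion /= big_nil subr0 SM.
under eq_bigr do rewrite remainderS //.
apply: (@le_trans _ _ (\sum_(i < N) \sum_(k < d)
    `|prim (fun r => (A k *m remainder m r) i 0 * v k r) t|)).
  by apply: ler_sum => i _; apply: ler_norm_sum.
apply: (picard_step iv (g := fun i k r => (A k *m remainder m r) i 0)) => //.
  by move=> i k; apply: continuous01_mulmx.
move=> k r r01; apply: (le_trans (norm_mulmx_le _ _)).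
rewrite [leRHS](_ : _ = Lam * ((\sum_i M i) * Lam ^+ m * travel_bound v m r)); last first.
  by rewrite exprS; ring.
apply: ler_wpM2l; first by do 3!apply: sumr_ge0 => ? _.
exact: IH.
Qed.

Lemma expansion_cvg t i : t \in `[0, 1]%R -> (fun m => expansion m t i 0) @ \oo --> S t i 0.
Proof.
move=> t01; have [M M0 HM] := remainder_le.
have cvg0 : (fun m => M * exp_coeff (Lam * travel v t) m) @ \oo --> 0.
  rewrite -[X in _ --> X](mulr0 M); apply: cvgM; first exact: cvg_cst.
  exact: cvg_series_cvg_0 (is_cvg_series_exp_coeff _).
have : (fun m => S t i 0 - remainder m t i 0) @ \oo --> S t i 0 - 0.
  apply: cvgB; first exact: cvg_cst.
  apply/norm_cvg0P; apply: squeeze_cvgr (cvg_cst 0) cvg0.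
  apply: nearW => m; rewrite normr_ge0 /=.
  apply: (@le_trans _ _ (\sum_(i < N) `|remainder m t i 0|)).
    by rewrite (bigD1 i) //= lerDl; apply: sumr_ge0.
  rewrite (le_trans (HM m t t01)) // /travel_bound /exp_coeff /= exprMn.
  by rewrite !mulrA.
rewrite subr0; under eq_fun do rewrite /remainder mxE [X in _ - (_ + X)]mxE opprD opprK addrA subrr add0r.
by [].
Qed.

End Expansion.

(** * Expansion of the limit kernel *)

Section Clamp.
Context {R : realType}.

(** The retraction of the line onto [0, 1], through which a function on the unit square
extends to a continuous function on the plane. *)
Definition clamp (r : R) : R := Num.max 0 (Num.min r 1).

Lemma clamp_itv r : clamp r \in `[0, 1]%R.
Proof. by rewrite in_itv /= le_max lexx ge_max ler01 ge_min lexx orbT. Qed.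

Lemma clamp_id r : r \in `[0, 1]%R -> clamp r = r.
Proof.
by rewrite in_itv /= => /andP[r0 r1]; rewrite /clamp (min_idPl r1) (max_idPr r0).
Qed.

Lemma clampE r : clamp r = (`|r| - `|r - 1| + 1) / 2.
Proof.
rewrite /clamp; have [r1|r1] := leP r 1; have [r0|r0] := leP 0 r.
- by rewrite ger0_norm // ler0_norm ?subr_le0 //; lra.
- by rewrite ltr0_norm // ler0_norm ?subr_le0 //; lra.
- by rewrite (max_idPr ler01) ger0_norm // ger0_norm ?subr_ge0 ?ltW //; lra.
- by have := lt_trans r0 (lt_trans ltr01 r1); rewrite ltxx.
Qed.

Lemma continuous_clamp : continuous clamp.
Proof.
have -> : clamp = (fun r => (`|r| - `|r - 1| + 1) / 2) by apply/funext/clampE.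
move=> x; apply: cvgM; last exact: cvg_cst.
apply: cvgD; last exact: cvg_cst.
apply: cvgB; first exact: norm_continuous.
by apply: cvg_norm; apply: cvgB; [exact: cvg_id|exact: cvg_cst].
Qed.

Lemma within_continuous_comp (T U V : topologicalType) (B : set U) (f : U -> V) (c : T -> U) :
  {within B, continuous f} -> continuous c -> (forall x, B (c x)) -> continuous (f \o c).
Proof.
move=> /subspace_continuousP cf cc cB x.
move=> W /(cf (c x) (cB x)) WB.
have := cc x _ WB; rewrite !nbhs_simpl /=; apply: filterS => y /=; apply; exact: cB.
Qed.
End Clamp.

Section Square.
Context {R : realType}.
Variable K : R -> R -> R.
Local Notation mu := (@lebesgue_measure R).
Local Notation square := (`[0, 1]%classic `*` `[0, 1]%classic : set (R * R)).
Hypothesis cK : {within square, continuous (fun p : R * R => K p.1 p.2)}.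

Let Kc x y := K (clamp x) (clamp y).

Let continuous_Kc : continuous (fun p : R * R => Kc p.1 p.2).
Proof.
apply: (within_continuous_comp (c := fun p : R * R => (clamp p.1, clamp p.2)) cK).
  move=> p.
  have c1 : clamp q.1 @[q --> p] --> clamp p.1.
    by apply: (cvg_comp fst clamp); [exact: cvg_fst|exact: continuous_clamp].
  have c2 : clamp q.2 @[q --> p] --> clamp p.2.
    by apply: (cvg_comp snd clamp); [exact: cvg_snd|exact: continuous_clamp].
  exact: (cvg_pair c1 c2).
by move=> p; split; apply: clamp_itv.
Qed.

Let continuous_Kc1 y : continuous (fun x => Kc x y).
Proof.
move=> x; apply: (@continuous_comp _ _ _ (fun x : R => (x, y)) (fun p : R * R => Kc p.1 p.2) x).
  exact: (cvg_pair cvg_id (cvg_cst y)).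
exact: (@continuous_Kc (x, y)).
Qed.

Let continuous_Kc2 x : continuous (Kc x).
Proof.
move=> y; apply: (@continuous_comp _ _ _ (fun y : R => (x, y)) (fun p : R * R => Kc p.1 p.2) y).
  exact: (cvg_pair (cvg_cst x) cvg_id).
exact: (@continuous_Kc (x, y)).
Qed.

Lemma square_bounded : exists2 M, 0 <= M & forall x y,
  x \in `[0, 1]%R -> y \in `[0, 1]%R -> `|K x y| <= M.
Proof.
have /compact_bounded[M [_ HM]] : compact ((fun p : R * R => K p.1 p.2) @` square).
  apply: continuous_compact => //; apply: compact_setX; exact: segment_compact.
exists (`|M| + 1); first by rewrite addr_ge0.
move=> x y x01 y01; apply: (HM (`|M| + 1)); last by exists (x, y).
by rewrite (le_lt_trans (ler_norm M)) // ltrDl.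
Qed.

(** The kernel is only controlled inside the square, so its section is exchanged for a
function that is continuous on the interval and agrees with it there. *)
Lemma continuous01_section x : x \in `[0, 1]%R -> exists2 g, continuous01 g &
  forall y, y \in `[0, 1]%R -> g y = K x y.
Proof.
move=> x01; exists (Kc x); first exact: continuous_subspaceT (@continuous_Kc2 x).
by move=> y y01; rewrite /Kc !clamp_id.
Qed.

(** Continuity under the integral sign, for the extension of [K] by [clamp], with
dominating function [M * `|w|]. *)
Lemma continuous01_partial_integral w t : integrable01 w -> t \in `[0, 1]%R ->
  exists2 g, continuous01 g &
  forall x, x \in `[0, 1]%R -> g x = prim (fun y => K x y * w y) t.
Proof.
move=> iw t01; exists (fun x => prim (fun y => Kc x y * w y) t); last first.
  by move=> x x01; apply: eq_prim => // y y01; rewrite /Kc !clamp_id.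
have [M M0 HM] := square_bounded.
have integ x : mu.-integrable `[0, t] (EFin \o (fun y => Kc x y * w y)).
  apply: (integrable01S t01); apply: integrable01_mul => //.
  exact: continuous_subspaceT (@continuous_Kc2 x).
have cont : {in `](-1 : R), 2[%classic, continuous (fun x => prim (fun y => Kc x y * w y) t)}.
  apply: (@continuity_under_integral R _ _ mu (fun x y => Kc x y * w y)
    `[0, t]%classic _ (-1) 2 _ _ (fun y => M * `|w y|)) => //.
  - apply: aeW => y _ x _; apply: cvgM; [exact: continuous_Kc1|exact: cvg_cst].
  - apply: (integrable01S t01); apply: integrable01Z; exact: integrable01_norm.
  - move=> x _; apply: aeW => y _; rewrite normrM ler_wpM2r //.
    by apply: HM; apply: clamp_itv.
apply: continuous_in_subspaceT => x /set_mem; rewrite /= in_itv /= => /andP[x0 x1].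
by apply: cont; rewrite inE /= in_itv /=; apply/andP; split; lra.
Qed.
End Square.

Section Kernel.
Context {R : realType} {d : nat}.
Variables vx vy : 'I_d -> R -> R.
Hypothesis ivx : forall k, integrable01 (vx k).
Hypothesis ivy : forall k, integrable01 (vy k).
Variables (sa sA sb : R) (K : R -> R -> R).
Local Notation mu := (@lebesgue_measure R).
Hypothesis cK : {within (`[0, 1]%classic `*` `[0, 1]%classic : set (R * R)),
  continuous (fun p : R * R => K p.1 p.2)}.
Hypothesis eqK : forall s t, s \in `[0, 1]%R -> t \in `[0, 1]%R ->
  K s t = sa ^+ 2 + prim (fun x => prim (fun y =>
    (sA ^+ 2 * K x y + sb ^+ 2) * \sum_(k < d) vx k x * vy k y) t) s.
Local Notation iword := (seq 'I_d * option 'I_d)%type.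

Definition kernel_coef (p : iword) : R :=
  vector_variance sa sb p.2 * sA ^+ (size p.1 + size p.1).

Definition kernel_expansion m s t := \sum_(p <- upto d m)
  kernel_coef p * (iterated_integral vx p s * iterated_integral vy p t).

Let err m s t := K s t - kernel_expansion m s t.

Lemma kernel_coef_cons k p : kernel_coef (cons_word k p) = sA ^+ 2 * kernel_coef p.
Proof. by rewrite /kernel_coef /= addSn addnS !exprS; ring. Qed.

Lemma kernel_expansionS m s t : kernel_expansion m.+1 s t =
  sa ^+ 2 + \sum_(k < d) sb ^+ 2 * (prim (vx k) s * prim (vy k) t) +
  \sum_(k < d) \sum_(p <- upto d m) sA ^+ 2 * kernel_coef p *
    (prim (fun r => iterated_integral vx p r * vx k r) s *
     prim (fun r => iterated_integral vy p r * vy k r) t).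
Proof.
rewrite /kernel_expansion sum_uptoS; congr (_ + _ + _).
- by rewrite /kernel_coef /= expr0 !mulr1.
- by apply: eq_bigr => k _; rewrite /kernel_coef /= expr0 mulr1.
by apply: eq_bigr => k _; apply: eq_bigr => p _; rewrite kernel_coef_cons.
Qed.

Let int_iter (v : 'I_d -> R -> R) (iv : forall k, integrable01 (v k)) p k :
  integrable01 (fun r => iterated_integral v p r * v k r).
Proof. by apply: integrable01_mul => //; apply: continuous01_iterated. Qed.

Let int_section x w : x \in `[0, 1]%R -> integrable01 w -> integrable01 (fun y => K x y * w y).
Proof.
move=> x01 iw; have [g cg gE] := continuous01_section cK x01.
apply: eq_integrable (integrable01_mul cg iw) => // y; rewrite inE => y01 /=.
by rewrite gE.
Qed.

Let err_section x m : x \in `[0, 1]%R -> exists2 g, continuous01 g &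
  forall y, y \in `[0, 1]%R -> g y = err m x y.
Proof.
move=> x01; have [g cg gE] := continuous01_section cK x01.
exists (fun y => g y - kernel_expansion m x y); last by move=> y y01; rewrite gE.
apply: continuous01B => //; apply: continuous01_sum => p.
apply: continuous01M; first exact: continuous01_cst.
by apply: continuous01M; [exact: continuous01_cst|exact: continuous01_iterated].
Qed.

(** The error of the expansion satisfies the linear part of the equation of [K]. The
inner integrals [g k] are continuous in the outer variable, being the difference of
a partial integral of [K] and of a finite sum. *)
Lemma err_step m t : t \in `[0, 1]%R -> exists g : 'I_d -> R -> R,
  [/\ forall k, continuous01 (g k),
      forall k x, x \in `[0, 1]%R -> g k x = prim (fun y => err m x y * vy k y) t &
      forall s, s \in `[0, 1]%R ->
        err m.+1 s t = \sum_(k < d) prim (fun x => sA ^+ 2 * g k x * vx k x) s].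
Proof.
move=> t01.
have /choice[G HG] : forall k, exists G, continuous01 G /\
    forall x, x \in `[0, 1]%R -> G x = prim (fun y => K x y * vy k y) t.
  by move=> k; have [G cG GE] := continuous01_partial_integral cK (ivy k) t01; exists G.
pose H k x := \sum_(p <- upto d m) kernel_coef p *
   (iterated_integral vx p x * prim (fun r => iterated_integral vy p r * vy k r) t).
have cH k : continuous01 (H k).
  apply: continuous01_sum => p; apply: continuous01M; first exact: continuous01_cst.
  by apply: continuous01M; [exact: continuous01_iterated|exact: continuous01_cst].
have HE k x : x \in `[0, 1]%R -> H k x = prim (fun y => kernel_expansion m x y * vy k y) t.
  move=> x01; rewrite /H.
  transitivity (\sum_(p <- upto d m) prim (fun y => kernel_coef p * iterated_integral vx p x *
    (iterated_integral vy p y * vy k y)) t).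
    by apply: eq_bigr => p _; rewrite primZ ?mulrA //; apply: int_iter.
  rewrite -prim_sum //; last by move=> p; apply: integrable01Z; apply: int_iter.
  apply: eq_prim => // y _; rewrite /kernel_expansion mulr_suml.
  by apply: eq_bigr => p _; ring.
have cE x : continuous01 (fun y => kernel_expansion m x y).
  apply: continuous01_sum => p; apply: continuous01M; first exact: continuous01_cst.
  by apply: continuous01M; [exact: continuous01_cst|exact: continuous01_iterated].
exists (fun k x => G k x - H k x); split.
- by move=> k; apply: continuous01B => //; case: (HG k).
- move=> k x x01; rewrite HE // (HG k).2 // -primB //; last 2 first.
  + exact: int_section.
  + exact: integrable01_mul.
  by apply: eq_prim => // y _; rewrite mulrBl.
move=> s s01.
have iG k : integrable01 (fun x => G k x * vx k x).
  by apply: integrable01_mul => //; case: (HG k).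
have iH k : integrable01 (fun x => H k x * vx k x) by apply: integrable01_mul.
have KE : K s t = sa ^+ 2 + \sum_(k < d)
   (sA ^+ 2 * prim (fun x => G k x * vx k x) s + sb ^+ 2 * (prim (vx k) s * prim (vy k) t)).
  rewrite eqK //; congr (_ + _).
  transitivity (prim (fun x => \sum_(k < d) (sA ^+ 2 * (G k x * vx k x) +
     sb ^+ 2 * prim (vy k) t * vx k x)) s).
    apply: eq_prim => // x x01.
    transitivity (prim (fun y => \sum_(k < d) (sA ^+ 2 * vx k x * (K x y * vy k y) +
      sb ^+ 2 * vx k x * vy k y)) t).
      by apply: eq_prim => // y y01; rewrite mulr_sumr; apply: eq_bigr => k _; ring.
    have iK k := int_section x01 (ivy k).
    rewrite prim_sum //; last first.
      by move=> k; apply: integrable01D; apply: integrable01Z.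
    apply: eq_bigr => k _; rewrite primD; [|by []|exact: integrable01Z|exact: integrable01Z].
    by rewrite !primZ // (HG k).2 //; ring.
  rewrite prim_sum //; last first.
    by move=> k; apply: integrable01D; apply: integrable01Z.
  apply: eq_bigr => k _; rewrite primD; [|by []|exact: integrable01Z|exact: integrable01Z].
  by rewrite !primZ //; ring.
rewrite /err KE kernel_expansionS big_split /=.
have -> : \sum_(k < d) prim (fun x => sA ^+ 2 * (G k x - H k x) * vx k x) s =
   \sum_(k < d) sA ^+ 2 * prim (fun x => G k x * vx k x) s -
   \sum_(k < d) sA ^+ 2 * prim (fun x => H k x * vx k x) s.
  rewrite -sumrB; apply: eq_bigr => k _; rewrite -mulrBr -primB // -primZ //.
    by apply: eq_prim => // x _; ring.
  exact: integrable01B.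
have -> : \sum_(k < d) sA ^+ 2 * prim (fun x => H k x * vx k x) s =
  \sum_(k < d) \sum_(p <- upto d m) sA ^+ 2 * kernel_coef p *
    (prim (fun r => iterated_integral vx p r * vx k r) s *
     prim (fun r => iterated_integral vy p r * vy k r) t).
  apply: eq_bigr => k _; rewrite -primZ //.
  transitivity (prim (fun x => \sum_(p <- upto d m) sA ^+ 2 * kernel_coef p *
     prim (fun r => iterated_integral vy p r * vy k r) t * (iterated_integral vx p x * vx k x)) s).
    apply: eq_prim => // x _; rewrite /H mulr_suml mulr_sumr; apply: eq_bigr => p _; ring.
  rewrite prim_sum //; last by move=> p; apply: integrable01Z; apply: int_iter.
  by apply: eq_bigr => p _; rewrite primZ ?int_iter //; ring.
by ring.
Qed.
(** Picard iteration in both variables at the same time: [picard_step] is applied to the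
inner integral along one path and to the outer integral along the other. *)
Lemma err_le : exists2 M, 0 <= M & forall m s t,
  s \in `[0, 1]%R -> t \in `[0, 1]%R ->
  `|err m s t| <= M * (sA ^+ 2) ^+ m * (travel_bound vx m s * travel_bound vy m t).
Proof.
have [M M0 HM] := square_bounded cK; exists M => //.
elim=> [|m IH] s t s01 t01.
  rewrite /travel_bound !expr0 fact0 divr1 !mulr1 /err /kernel_expansion /= big_nil subr0.
  exact: HM.
have [g [cg gE errE]] := err_step m t01.
rewrite errE //.
pose c := M * (sA ^+ 2) ^+ m * travel_bound vy m.+1 t.
have gle k x : x \in `[0, 1]%R -> `|g k x| <= c * travel_bound vx m x.
  move=> x01; rewrite gE //.
  have [f cf fE] := err_section m x01.
  have := picard_step ivy (s := [:: tt]) (g := fun _ _ => f)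
    (c := M * (sA ^+ 2) ^+ m * travel_bound vx m x) (m := m) (t := t).
  rewrite big_seq1 => H.
  have {}H : \sum_(k < d) `|prim (fun y => f y * vy k y) t| <=
      M * (sA ^+ 2) ^+ m * travel_bound vx m x * travel_bound vy m.+1 t.
    by apply: H => // l y y01; rewrite big_seq1 fE // -[leRHS]mulrA; apply: IH.
  have -> : c * travel_bound vx m x =
      M * (sA ^+ 2) ^+ m * travel_bound vx m x * travel_bound vy m.+1 t.
    by rewrite /c mulrAC.
  apply: le_trans H; rewrite (bigD1 k) //=.
  rewrite (@eq_prim _ _ (fun y => f y * vy k y)) // => [|y y01]; last by rewrite fE.
  by rewrite lerDl sumr_ge0.
have := picard_step ivx (s := [:: tt]) (g := fun _ k x => sA ^+ 2 * g k x)
    (c := sA ^+ 2 * c) (m := m) (t := s).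
rewrite big_seq1 => H.
have -> : M * (sA ^+ 2) ^+ m.+1 * (travel_bound vx m.+1 s * travel_bound vy m.+1 t) =
    sA ^+ 2 * c * travel_bound vx m.+1 s.
  by rewrite /c exprS; ring.
apply: le_trans (ler_norm_sum _ _ _) _; apply: H => //.
  by move=> _ k; apply: continuous01M => //; apply: continuous01_cst.
move=> k x x01; rewrite big_seq1 normrM ger0_norm ?sqr_ge0 // -mulrA ler_wpM2l ?sqr_ge0 //.
exact: gle.
Qed.

Lemma kernel_expansion_cvg s t : s \in `[0, 1]%R -> t \in `[0, 1]%R ->
  (fun m => kernel_expansion m s t) @ \oo --> K s t.
Proof.
move=> s01 t01; have [M M0 HM] := err_le.
have cvg0 : (fun m => M * (exp_coeff (sA ^+ 2 * travel vx s) m * exp_coeff (travel vy t) m))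
    @ \oo --> 0.
  rewrite -[X in _ --> X](mulr0 M); apply: cvgM; first exact: cvg_cst.
  rewrite -[X in _ --> X](mulr0 0); apply: cvgM;
    exact: cvg_series_cvg_0 (is_cvg_series_exp_coeff _).
have : (fun m => K s t - err m s t) @ \oo --> K s t - 0.
  apply: cvgB; first exact: cvg_cst.
  apply/norm_cvg0P; apply: squeeze_cvgr (cvg_cst 0) cvg0.
  apply: nearW => m; rewrite normr_ge0 /= (le_trans (HM m s t s01 t01)) //.
  by rewrite /travel_bound /exp_coeff /= [(sA ^+ 2 * travel vx s) ^+ m]exprMn !mulrA.
by rewrite subr0; under eq_fun do rewrite /err opprB addrCA subrr addr0.
Qed.

End Kernel.

(** * Uniform bounds on the expansions *)

(** The term is the geometric mean of [2^-1 ^+ j] and [(2 * y ^+ 2) ^+ j / j!], hence at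
most their sum, and both series converge. *)
Lemma sum_root_factorial_bounded {R : realType} (y : R) : 0 <= y ->
  exists B, forall m, \sum_(j < m) y ^+ j / Num.sqrt (j`!)%:R <= B.
Proof.
move=> y0; pose x := 2 * y ^+ 2.
have x0 : 0 <= x by rewrite mulr_ge0 ?sqr_ge0.
have term_le j : y ^+ j / Num.sqrt (j`!)%:R <= 2^-1 ^+ j + exp_coeff x j.
  have e0 : 0 <= exp_coeff x j by rewrite /exp_coeff /= divr_ge0 ?exprn_ge0.
  have g0 : 0 <= 2^-1 ^+ j :> R by rewrite exprn_ge0.
  rewrite -(@ler_pXn2r _ 2) ?nnegrE ?addr_ge0 ?divr_ge0 ?exprn_ge0 ?sqrtr_ge0 //.
  apply: (@le_trans _ _ (2^-1 ^+ j * exp_coeff x j)).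
    rewrite expr_div_n sqr_sqrtr // /exp_coeff /= /x [(2 * _) ^+ j]exprMn !mulrA -exprMn.
    by rewrite mulVf // expr1n mul1r -exprM mulnC exprM.
  rewrite sqrrD [leRHS]addrAC -[leLHS]add0r lerD ?addr_ge0 ?sqr_ge0 // mulr2n.
  by rewrite lerDl mulr_ge0.
exists (2 + limn (series (exp_coeff x))) => m.
apply: (@le_trans _ _ (\sum_(j < m) (2^-1 ^+ j + exp_coeff x j))).
  by apply: ler_sum => j _; apply: term_le.
rewrite big_split /= lerD //.
  have -> : \sum_(j < m) 2^-1 ^+ j = 2 - 2 * 2^-1 ^+ m :> R.
    elim: m => [|m IH]; first by rewrite big_ord0 expr0 mulr1 subrr.
    by rewrite big_ord_recr /= IH exprS; field.
  by rewrite lerBlDr lerDl mulr_ge0 // exprn_ge0.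
have := @nondecreasing_cvgn_le R (series (exp_coeff x)) _ (is_cvg_series_exp_coeff x) m.
rewrite /series /= big_mkord; apply.
move=> a b ab; rewrite /series /= -subr_ge0 sub_series_geq //.
by apply: sumr_ge0 => j _; rewrite /exp_coeff /= divr_ge0 ?exprn_ge0.
Qed.

Section PathBounds.
Context {R : realType} {d : nat}.
Local Notation mu := (@lebesgue_measure R).

Lemma square_integrable01 (f : R -> R) :
  measurable_fun (`[0, 1] : set R) f ->
  mu.-integrable `[0, 1] (fun t => ((f t) ^+ 2)%:E) -> integrable01 f.
Proof.
move=> mf if2.
have i1 : integrable01 (fun t => 1 + (f t) ^+ 2).
  apply: integrable01D => //.
  apply: continuous_compact_integrable; first exact: segment_compact.
  exact: (@continuous01_cst R 1).
apply: le_integrable i1 => //; first exact/measurable_EFinP.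
move=> t _ /=; rewrite lee_fin [leRHS]ger0_norm ?addr_ge0 ?sqr_ge0 //.
have [f1|f1] := leP `|f t| 1; first by rewrite (le_trans f1) // lerDl sqr_ge0.
rewrite -real_normK ?num_real // (le_trans _ (_ : `|f t| ^+ 2 <= _)) ?lerDr //.
by rewrite expr2 ler_peMr // ltW.
Qed.

Variable v : 'I_d -> R -> R.
Hypothesis iv : forall k, integrable01 (v k).

(** The factor [j!] that the iterated integrals gain beats the [sqrt j!] of the weights. *)
Lemma weighted_iterated_bounded (c : R) t : 0 <= c -> t \in `[0, 1]%R ->
  exists B, forall m, \sum_(p <- upto d m) `|iterated_integral v p t| *
    root_factorial_weight c (size p.1) <= B.
Proof.
move=> c0 t01; have l0 := travel_ge0 v t.
have [|B HB] := @sum_root_factorial_bounded R (2 * c * travel v t).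
  by rewrite !mulr_ge0.
have C0 : 0 <= 1 + travel v 1 by rewrite addr_ge0 // travel_ge0.
exists ((1 + travel v 1) * B) => m; rewrite sum_upto.
apply: le_trans (ler_wpM2l C0 (HB m)); rewrite mulr_sumr; apply: ler_sum => j _.
rewrite big_seq (eq_bigr (fun p => `|iterated_integral v p t| * root_factorial_weight c j));
  last by move=> p /size_level ->.
rewrite -big_seq -mulr_suml.
have w0 : 0 <= root_factorial_weight c j.
  by rewrite (le_trans _ (root_factorial_weight_ge j c0)) // exprn_ge0.
apply: le_trans (ler_wpM2r w0 (sum_iterated_level_le iv j t01)) _.
rewrite -[X in X <= _]mulrA; apply: ler_wpM2l => //; rewrite /travel_bound /root_factorial_weight.
have s0 : Num.sqrt (j`!)%:R != 0 :> R by rewrite sqrtr_eq0 -ltNge ltr0n fact_gt0.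
have sE : (j`!)%:R = Num.sqrt (j`!)%:R ^+ 2 :> R by rewrite sqr_sqrtr.
rewrite [(_ * travel v t) ^+ j]exprMn [X in _ / X * _]sE.
by rewrite le_eqVlt; apply/orP; left; apply/eqP; field.
Qed.

End PathBounds.

(** * Convergence in mean square *)

Section Limit.
Context {disp : measure_display} {Omega : measurableType disp} {R : realType}.
Variable P : probability Omega R.

Lemma fatou_mean_square (f : nat -> Omega -> R) (g : Omega -> R) (c : \bar R) :
  (forall m, measurable_fun setT (f m)) ->
  (forall w, (fun m => f m w) @ \oo --> g w) ->
  (forall m, (\int[P]_w (f m w ^+ 2)%:E <= c)%E) ->
  measurable_fun setT g /\ (\int[P]_w (g w ^+ 2)%:E <= c)%E.
Proof.
move=> mf cf fc; have mg : measurable_fun setT g.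
  by apply: (measurable_fun_cvg mf) => w _; exact: cf.
split => //.
(* the square of a pointwise limit is a lower limit, to which Fatou's lemma applies *)
have gE w : limn_einf (fun m => (f m w ^+ 2)%:E) = (g w ^+ 2)%:E.
  have : (fun m => (f m w ^+ 2)%:E) @ \oo --> (g w ^+ 2)%:E.
    apply: cvg_EFin; first exact: nearW.
    by apply: (@cvg_comp _ _ _ (fun m => f m w) (fun x => x ^+ 2) _ _ _ (cf w));
      exact: exprn_continuous.
  by move=> h; rewrite (cvg_limn_einf_sup h).1.
under eq_integral do rewrite -gE.
apply: le_trans (fatou P measurableT _ _) _.
- by move=> m; apply/measurable_EFinP; apply: measurable_funX.
- by move=> m w _; rewrite lee_fin sqr_ge0.
rewrite limn_einf_lim; apply: lime_le; first exact: is_cvg_einfs.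
apply: nearW => m; apply: le_trans (fc m).
by apply: ereal_inf_lbound; exists m => /=.
Qed.

Lemma Lnorm2E (f : Omega -> R) :
  ('N[P]_2%:E [EFin \o f] = sqrte (\int[P]_w (f w ^+ 2)%R%:E))%E.
Proof.
rewrite unlock /= -poweR12_sqrt; last by apply: integral_ge0 => w _; rewrite lee_fin sqr_ge0.
congr (_ `^ _)%E; apply: eq_integral => w _.
by rewrite /= -real_normK ?num_real // -powR_mulrn.
Qed.

(** The rate implies membership in [L2] as well, because constants are square integrable
for a probability. *)
Lemma cvg_in_L2_rate (Z : nat -> Omega -> R) (c C : R) :
  (forall N, measurable_fun setT (Z N)) -> (forall w, Z 0%N w = 0) ->
  (forall N, (0 < N)%N -> (\int[P]_w ((Z N w - c) ^+ 2)%:E <= (C / N%:R)%:E)%E) ->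
  cvg_in_L2 P Z c.
Proof.
move=> mZ Z0 ZC.
have C0 : 0 <= C.
  have := ZC 1%N isT; rewrite divr1 -lee_fin; apply: le_trans.
  by apply: integral_ge0 => w _; rewrite lee_fin sqr_ge0.
have norm_le N : (0 < N)%N ->
    ('N[P]_2%:E [EFin \o (fun w => Z N w - c)%R] <= (Num.sqrt (C / N%:R))%:E)%E.
  by move=> N0; rewrite Lnorm2E -[leRHS]/(sqrte (C / N%:R)%:E) lee_sqrt ?ZC // lee_fin divr_ge0.
split=> [N|].
  have -> : Z N = (fun w => Z N w - c) \+ cst c by apply/funext => w /=; rewrite subrK.
  have p1 : (1 <= 2%:E :> \bar R)%E by rewrite lee1n.
  apply: (Lfun_addr_closed P p1).2; last exact: Lfun_cst.
  have [->|N0] := posnP N.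
    by rewrite (_ : (fun _ => _) = cst (- c)); [exact: Lfun_cst|apply/funext => w; rewrite Z0 sub0r].
  rewrite inE; apply/andP; split; rewrite inE /=.
    by apply: measurable_funB => //; exact: measurable_cst.
  exact: le_lt_trans (norm_le N N0) (ltry _).
have quotient0 : (fun N => C / N%:R) @ \oo --> C * 0.
  apply: cvgM; first exact: cvg_cst.
  apply/gtr0_cvgV0; first by exists 1%N => // n /= n0; rewrite ltr0n.
  exact: cvgr_idn.
have : (fun N => (Num.sqrt (C / N%:R))%:E) @ \oo --> (Num.sqrt (C * 0))%:E.
  apply: cvg_EFin; first exact: nearW.
  by apply: (@cvg_comp _ _ _ (fun N => C / N%:R) Num.sqrt _ _ _ quotient0);
    exact: sqrt_continuous.
rewrite mulr0 sqrtr0.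
apply: (@squeeze_cvge _ _ _ _ (cst 0%E)); last exact: cvg_cst.
by exists 1%N => // N /= N0; rewrite Lnorm_ge0 norm_le.
Qed.

End Limit.

Section Coordinates.
Context {R : realType} {d : nat}.

Lemma is_L2_derivative_integrable (x v : R -> 'cV[R]_d) k :
  is_L2_derivative x v -> integrable01 (fun r => v r k 0).
Proof. by case=> /(_ k)[mv iv2] _; apply: square_integrable01. Qed.

Lemma CDE_continuous N (S : R -> 'cV[R]_N) i :
  {within (`[0, 1] : set R), continuous S} -> continuous01 (fun t => S t i 0).
Proof.
move=> cS r.
apply: (@cvg_comp _ _ _ S (fun M : 'cV[R]_N => M i 0) _ (nbhs (S r))); first exact: cS.
exact: (@coord_continuous R N 1 i 0 (S r)).
Qed.

(** The limits of the forms select the diagonal words, and these are listed without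
repetition. *)
Lemma kernel_expansion_qlimit (vx vy : 'I_d -> R -> R) sa sA sb m s t :
  \sum_(p <- upto d m) \sum_(r <- upto d m)
    iterated_integral vx p s * iterated_integral vy r t * qlimit sa sA sb p r =
  kernel_expansion vx vy sa sA sb m s t.
Proof.
rewrite /kernel_expansion !big_seq; apply: eq_bigr => p pm.
rewrite (bigD1_seq p) ?uniq_upto //= big1 ?addr0 => [|r rp].
  by rewrite /qlimit !eqxx !mul1r /kernel_coef mulrC.
rewrite /qlimit; case: p r rp {pm} => [J u] [J' u'] /=; rewrite xpair_eqE negb_and.
by case/orP => /negPf ->; rewrite !(mul0r, mulr0).
Qed.
End Coordinates.

Section Flow.
Context {R : realType} {d : nat}.
Context {disp : measure_display} {Omega : measurableType disp}.
Variable P : probability Omega R.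
Variables (N : nat) (a : 'I_N -> {RV P >-> R}) (A : 'I_d -> 'I_N -> 'I_N -> {RV P >-> R})
  (b : 'I_d -> 'I_N -> {RV P >-> R}).

Lemma CDE_expansion_cvg (x v : R -> 'cV[R]_d) (S : R -> 'cV[R]_N) w t i :
  is_L2_derivative x v ->
  is_CDE_solution v (\col_al a al w) (fun k => \matrix_(al, be) A k al be w)
    (fun k => \col_al b k al w) S -> t \in `[0, 1]%R ->
  (fun m => expansion (fun k r => v r k 0) (sample_matrix A w) (sample_vector a b w) m t i 0)
    @ \oo --> S t i 0.
Proof.
move=> dv [cS eqS] t01; apply: expansion_cvg => //.
- by move=> k; apply: is_L2_derivative_integrable dv.
- by move=> j; apply: CDE_continuous.
move=> r r01 j; rewrite eqS // mxE summxE; rewrite [X in X + _]mxE [X in _ = X + _]mxE; congr (_ + _).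
by apply: eq_bigr => k _; rewrite mxE.
Qed.

End Flow.

Lemma cvg_inner {R : realType} n (u v : nat -> 'cV[R]_n) (u' v' : 'cV[R]_n) :
  (forall i, (fun m => u m i 0) @ \oo --> u' i 0) ->
  (forall i, (fun m => v m i 0) @ \oo --> v' i 0) ->
  (fun m => inner (u m) (v m)) @ \oo --> inner u' v'.
Proof.
move=> cu cv; rewrite /inner; elim: (index_enum 'I_n) => [|i r IH].
  by rewrite big_nil; under eq_fun do rewrite big_nil; exact: cvg_cst.
rewrite big_cons; under eq_fun do rewrite big_cons.
by apply: cvgD IH; apply: cvgM; [exact: cu|exact: cv].
Qed.

Theorem theorem4p4
  (R : realType) (d : nat) (sigma_a sigma_A sigma_b : R)
  (ha : 0 < sigma_a) (hA : 0 < sigma_A) (hb : 0 <= sigma_b)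
  (disp : measure_display) (Omega : measurableType disp)
  (P : probability Omega R)
  (a : forall N : nat, 'I_N -> {RV P >-> R})
  (A : forall N : nat, 'I_d -> 'I_N -> 'I_N -> {RV P >-> R})
  (b : forall N : nat, 'I_d -> 'I_N -> {RV P >-> R})
  (hw : forall N : nat,
     gaussian_weights sigma_a sigma_A sigma_b (a N) (A N) (b N))
  (x y : R -> 'cV[R]_d) (hx : in_X x) (hy : in_X y)
  (dx dy : R -> 'cV[R]_d)
  (hdx : is_L2_derivative x dx) (hdy : is_L2_derivative y dy)
  (Sx Sy : forall N : nat, Omega -> R -> 'cV[R]_N)
  (hSx : forall (N : nat) (w : Omega),
     is_CDE_solution dx (\col_al a N al w)
       (fun k => \matrix_(al, be) A N k al be w)
       (fun k => \col_al b N k al w) (Sx N w))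
  (hSy : forall (N : nat) (w : Omega),
     is_CDE_solution dy (\col_al a N al w)
       (fun k => \matrix_(al, be) A N k al be w)
       (fun k => \col_al b N k al w) (Sy N w))
  (K : R -> R -> R) (hK : is_K_id sigma_a sigma_A sigma_b dx dy K)
  (s t : R) (hs : s \in `[0, 1]%R) (ht : t \in `[0, 1]%R) :
  let Z (N : nat) (w : Omega) : R :=
    N%:R^-1 * inner (Sx N w s) (Sy N w t) in
  cvg_in_L2 P Z (K s t) /\
  exists C : R, \forall N \near \oo,
    ('E_P[(fun w => (Z N w - K s t) ^+ 2)%R] <= (C / N%:R)%:E)%E.
Proof.
move=> Z.
pose vx k r := dx r k 0; pose vy k r := dy r k 0.
have ivx k : integrable01 (vx k) by apply: is_L2_derivative_integrable hdx.
have ivy k : integrable01 (vy k) by apply: is_L2_derivative_integrable hdy.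
have [Bx HBx] := weighted_iterated_bounded ivx (ltW hA) hs.
have [By HBy] := weighted_iterated_bounded ivy (ltW hA) ht.
have cvgK : (fun m => kernel_expansion vx vy sigma_a sigma_A sigma_b m s t) @ \oo --> K s t.
  by case: hK => cK eqK; apply: kernel_expansion_cvg.
(* the bounds [Bx] and [By] do not depend on [N], hence neither does [C] *)
pose C := 5 * (sigma_a ^+ 2 + sigma_b ^+ 2) ^+ 2 * (Bx ^+ 2 * By ^+ 2).
have main N : (0 < N)%N -> measurable_fun setT (fun w => Z N w - K s t) /\
    (\int[P]_w ((Z N w - K s t) ^+ 2)%:E <= (C / N%:R)%:E)%E.
  move=> N0.
  pose F m w := N%:R^-1 * inner
      (expansion vx (sample_matrix (A N) w) (sample_vector (a N) (b N) w) m s)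
      (expansion vy (sample_matrix (A N) w) (sample_vector (a N) (b N) w) m t)
    - kernel_expansion vx vy sigma_a sigma_A sigma_b m s t.
  have forms m : measurable_fun setT (F m) /\ (\int[P]_w (F m w ^+ 2)%:E <= (C / N%:R)%:E)%E.
    have := mean_square_forms N0 (ltW hA) (hw N) (upto d m)
      (fun p => iterated_integral vx p s) (fun p => iterated_integral vy p t).
    rewrite kernel_expansion_qlimit => -[mF FC]; split=> //; apply: le_trans FC _.
    rewrite lee_fin /C [leRHS]mulrAC ler_wpM2l ?divr_ge0 ?mulr_ge0 ?addr_ge0 ?sqr_ge0 //.
    have h0 v r : 0 <= \sum_(p <- upto d m) `|iterated_integral v p r| *
        root_factorial_weight sigma_A (size p.1).
      apply: sumr_ge0 => p _; rewrite mulr_ge0 //.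
      exact: le_trans (exprn_ge0 _ (ltW hA)) (root_factorial_weight_ge _ (ltW hA)).
    by rewrite ler_pM ?sqr_ge0 // lerXn2r ?nnegrE ?(le_trans (h0 _ _) (HBx m)) ?(le_trans (h0 _ _) (HBy m)).
  apply: (@fatou_mean_square _ _ _ P F) => [m|w|m]; [by case: (forms m)| |by case: (forms m)].
  apply: cvgB cvgK; apply: cvgM; first exact: cvg_cst.
  apply: cvg_inner => i.
    exact: CDE_expansion_cvg hdx (hSx N w) hs.
  exact: CDE_expansion_cvg hdy (hSy N w) ht.
have mZ N : measurable_fun setT (Z N).
  have [->|N0] := posnP N.
    rewrite (_ : Z 0%N = cst 0); first exact: measurable_cst.
    by apply/funext => w; rewrite /Z invr0 mul0r.
  have [mZK _] := main N N0.
  rewrite (_ : Z N = fun w => Z N w - K s t + K s t).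
    by apply: measurable_funD => //; exact: measurable_cst.
  by apply/funext => w; rewrite subrK.
split.
  apply: (@cvg_in_L2_rate _ _ _ _ _ _ C) => // [w|N N0]; first by rewrite /Z invr0 mul0r.
  by case: (main N N0).
exists C; exists 1%N => // N /= N0; rewrite unlock.
by case: (main N N0).
Qed.
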